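(* Let $s\in(0,1)$, $0<\lambda\le\Lambda$, and let $L_{K^{(t)}}\in\mathcal L_s(\lambda,\Lambda;1)$ for every $t\in[0,\infty)$. Let $\eta_1:[0,1]\to[0,\infty)$ be such that $\eta_1^{2s}\in C^{0,1}([0,1])$, let $\eta_2\in C^{1,1}_c(B_1)$ with $\eta_2\ge0$, and set $\eta(t,x):=\eta_1(t)\eta_2(x)$. Then there exists $\sigma_0=\sigma_0(n,s,\lambda,\Lambda,\|\eta_1^{2s}\|_{C^{0,1}([0,1])},\|\eta_2\|_{C^{1,1}(B_1)})>0$ such that for every $\sigma\ge\sigma_0$, every $e\in\mathbb S^{n-1}$ and all $u,v\in C^\infty((0,\infty)\times\mathbb R^n)$ for which the expressions below are well-defined, the inequalities $$(\partial_t+L_{K^{(t)}})\big(\eta^2(\partial_eu)^2+\sigma u^2\big)\le2\eta^2(\partial_t+L_{K^{(t)}})(\partial_eu)\,\partial_eu+2\sigma(\partial_t+L_{K^{(t)}})(u)\,u,$$ $$(\partial_t+L_{K^{(t)}})\big(\eta^2(\partial_ev)_+^2+\sigma v^2\big)\le2\eta^2(\partial_t+L_{K^{(t)}})(\partial_ev)\,(\partial_ev)_++2\sigma(\partial_t+L_{K^{(t)}})(v)\,v$$ hold at all $(t,x)\in(0,1)\times\mathbb R^n$ such that $\eta_1^{2s}$ is differentiable at $t$.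
   Context: $B_1$ is the open unit ball of $\mathbb R^n$, $t_+=\max\{t,0\}$; $\eta_2$ is extended by $0$ to $\mathbb R^n$. Here $\partial_e$ is the spatial derivative in direction $e$, and $L_{K^{(t)}}$ acts in the $x$ variable at time $t$. Operators: $L_Ku(x)=\mathrm{p.v.}\int_{\mathbb R^n}(u(x)-u(y))K(x-y)\,dy$ with $K:\mathbb R^n\to[0,\infty]$ symmetric, $K(y)=K(-y)$. One writes $L_K\in\mathcal L_s(\lambda,\Lambda;1)$ if for all $y\neq0$: $\lambda|y|^{-n-2s}\le K(y)\le\Lambda|y|^{-n-2s}$ and $|\nabla K(y)|\le\Lambda|y|^{-1}K(y)$. *)

(* Defs.v *)
From HB Require Import structures.
From mathcomp Require Import all_boot all_order all_algebra.
From mathcomp Require Import all_classical all_reals all_analysis.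

Set Implicit Arguments.
Unset Strict Implicit.
Unset Printing Implicit Defensive.

Import Order.TTheory GRing.Theory Num.Theory.
Import numFieldNormedType.Exports.

Local Open Scope classical_set_scope.
Local Open Scope ring_scope.

(* R^n is 'rV[R]_n.  Its library norm is the sup norm, which
   gives the usual topology and differential calculus; all quantitative
   conditions use the Euclidean norm below. *)

Definition enorm (R : realType) (n : nat) (x : 'rV[R]_n) : R :=
  Num.sqrt (\sum_(i < n) x 0 i ^+ 2).

Definition eball (R : realType) (n : nat) : set 'rV[R]_n :=
  [set x | enorm x < 1].
Arguments eball : clear implicits.

Definition grad (R : realType) (n : nat) (f : 'rV[R]_n -> R) (x : 'rV[R]_n) :
  'rV[R]_n := \row_(i < n) 'D_(delta_mx 0 i) f x.

(* Lebesgue measure on R^n, on the product sigma-algebra of n.-tuple R: the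
   image of the product measure on R * R^(n-1) under the cons map. *)
Section lebesgue_tuple.
Variable R : realType.

Definition tcons (n : nat) (p : R * n.-tuple R) : n.+1.-tuple R :=
  [tuple of p.1 :: p.2].

Lemma measurable_tcons (n : nat) : measurable_fun setT (@tcons n).
Proof. by apply: measurable_cons; [exact: measurable_fst|exact: measurable_snd]. Qed.

Section step.
Variables (n : nat) (m : {sigma_finite_measure set (n.-tuple R) -> \bar R}).

Definition tcons_measure : set (n.+1.-tuple R) -> \bar R :=
  pushforward (@lebesgue_measure R \x m)%E (@tcons n).

Let tcons_measure0 : tcons_measure set0 = 0%E.
Proof. by rewrite /tcons_measure /pushforward preimage_set0 measure0. Qed.

Let tcons_measure_ge0 A : (0 <= tcons_measure A)%E.
Proof. exact: (measure_ge0 (lebesgue_measure \x m)%E). Qed.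

Let tcons_measure_sigma_additive : semi_sigma_additive tcons_measure.
Proof.
move=> F mF tF mUF; rewrite /tcons_measure /pushforward preimage_bigcup.
apply: measure_semi_sigma_additive.
- by move=> k; rewrite -[X in measurable X]setTI; exact: measurable_tcons.
- apply/trivIsetP => /= i j _ _ ij; rewrite -preimage_setI.
  by move/trivIsetP : tF => /(_ _ _ _ _ ij) ->//; rewrite preimage_set0.
- by rewrite -preimage_bigcup -[X in measurable X]setTI; exact: measurable_tcons.
Qed.

HB.instance Definition _ := isMeasure.Build _ _ _ tcons_measure
  tcons_measure0 tcons_measure_ge0 tcons_measure_sigma_additive.

Let tcons_measure_sigma_finite : sigma_finite setT tcons_measure.
Proof.
pose uncons (z : n.+1.-tuple R) : R * n.-tuple R := (thead z, [tuple of behead z]).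
have unconsK p : uncons (tcons p) = p.
  by case: p => a b; congr pair; apply: val_inj.
have muncons : measurable_fun setT uncons.
  apply: measurable_fun_pair; last exact: measurable_behead.
  exact: measurable_tnth.
have [F TF Foo] : sigma_finite setT (@lebesgue_measure R \x m)%E.
  have /sigma_finiteP[F [TF ndF Foo]] := sigma_finiteT (@lebesgue_measure R).
  have /sigma_finiteP[G [TG ndG Goo]] := sigma_finiteT m.
  exists (fun k => F k `*` G k).
    rewrite -setXTT TF TG predeqE => -[x y]; split.
      move=> [/= [i _ Fix] [k _ Gky]]; exists (maxn i k) => //; split.
      - by move: x Fix; exact/subsetPset/ndF/leq_maxl.
      - by move: y Gky; exact/subsetPset/ndG/leq_maxr.
    by move=> [k _ []/= ? ?]; split; exists k.
  move=> k; have [? ?] := Foo k; have [? ?] := Goo k.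
  split; first exact: measurableX.
  by rewrite product_measure1E// lte_mul_pinfty// ge0_fin_numE.
exists (fun k => uncons @^-1` F k).
  by rewrite -preimage_bigcup -TF preimage_setT.
move=> k; have [mF Fk] := Foo k; split.
  by rewrite -[X in measurable X]setTI; exact: muncons.
rewrite /tcons_measure /pushforward (_ : _ @^-1` _ = F k)//.
by apply/seteqP; split => p /=; rewrite unconsK.
Qed.

HB.instance Definition _ := Measure_isSigmaFinite.Build _ _ _ tcons_measure
  tcons_measure_sigma_finite.

End step.

Fixpoint lebesgue_tuple (n : nat) : {sigma_finite_measure set (n.-tuple R) -> \bar R} :=
  match n with
  | 0 => dirac [tuple]
  | n'.+1 => tcons_measure (lebesgue_tuple n')
  end.

Lemma lebesgue_tuple_box (n : nat) (A : 'I_n -> set R) :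
  (forall i, measurable (A i)) ->
  lebesgue_tuple n [set z | forall i, A i (tnth z i)] =
  (\prod_(i < n) lebesgue_measure (A i))%E.
Proof.
elim: n A => [|n IHn] A mA.
  by rewrite big_ord0 /= diracE mem_set// => -[].
pose A' i := A (lift ord0 i).
have mbox : measurable [set z : n.-tuple R | forall i, A' i (tnth z i)].
  rewrite (_ : [set _ | _] = \bigcap_(i in setT) ((@tnth n R)^~ i @^-1` A' i)).
    apply: fin_bigcap_measurable => // i _.
    by rewrite -[X in measurable X]setTI; apply: measurable_tnth => //; exact: mA.
  by apply/seteqP; split => z /= h i; [move=> _|]; apply: h.
rewrite big_ord_recl -(IHn A') => [|i]; last exact: mA.
rewrite -product_measure1E//=; last exact: mA.
rewrite /tcons_measure /pushforward; congr (product_measure1 _ _ _).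
apply/seteqP; split => [[a b] /= h|[a b] /= [ha hb] i].
  split; first exact: (h ord0).
  by move=> i; have := h (lift ord0 i); rewrite tnthS.
by case: (unliftP ord0 i) => [j ->|->]; [rewrite tnthS; exact: hb|].
Qed.

End lebesgue_tuple.

Definition rV_of_tuple (R : realType) (n : nat) (z : n.-tuple R) : 'rV[R]_n :=
  \row_(i < n) tnth z i.

(* The integrand of L_K u(x), with y read in its coordinates z. *)
Definition LK_integrand (R : realType) (n : nat) (K : 'rV[R]_n -> \bar R)
    (u : 'rV[R]_n -> R) (x : 'rV[R]_n) (z : n.-tuple R) : \bar R :=
  ((u x - u (rV_of_tuple z))%R%:E * K (x - rV_of_tuple z)%R)%E.

Definition off_ball (R : realType) (n : nat) (x : 'rV[R]_n) (r : R) :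
  set (n.-tuple R) := [set z | r <= enorm (x - rV_of_tuple z)].

Definition LK_trunc (R : realType) (n : nat) (K : 'rV[R]_n -> \bar R)
    (u : 'rV[R]_n -> R) (x : 'rV[R]_n) (r : R) : R :=
  fine (\int[lebesgue_tuple R n]_(z in off_ball x r) LK_integrand K u x z).

Definition LK (R : realType) (n : nat) (K : 'rV[R]_n -> \bar R)
    (u : 'rV[R]_n -> R) (x : 'rV[R]_n) : R :=
  lim (LK_trunc K u x r @[r --> 0^'+]).

(* The principal value makes sense at x: Lebesgue integrability off every ball
   about x, and existence of the limit. *)
Definition LK_defined (R : realType) (n : nat) (K : 'rV[R]_n -> \bar R)
    (u : 'rV[R]_n -> R) (x : 'rV[R]_n) : Prop :=
  (forall r : R, 0 < r ->
     (lebesgue_tuple R n).-integrable (off_ball x r) (LK_integrand K u x)) /\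
  cvg (LK_trunc K u x r @[r --> 0^'+]).

(* The class L_s(lam, Lam; 1).  The bounds make K finite away from 0, where its
   gradient is that of the real-valued function fine \o K. *)
Definition Ls1 (R : realType) (n : nat) (s lam Lam : R)
    (K : 'rV[R]_n -> \bar R) : Prop :=
  [/\ forall y, (0 <= K y)%E,
      forall y, K (- y) = K y &
      forall y, y != 0 ->
        [/\ ((lam * enorm y `^ (- n%:R - 2 * s))%:E <= K y)%E,
            (K y <= (Lam * enorm y `^ (- n%:R - 2 * s))%:E)%E,
            differentiable (fine \o K) y &
            enorm (grad (fine \o K) y) <= Lam * (enorm y)^-1 * fine (K y)]].

(* For both norms below, a finite value encodes membership in the space (for
   C11_norm together with differentiability in the ball).  Difference quotients
   are taken over all pairs: those with equal entries contribute 0. *)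
Definition C01_norm (R : realType) (g : R -> R) : \bar R :=
  (ereal_sup [set `|g t|%:E | t in `[0%R, 1%R]] +
   ereal_sup [set (`|g p.1 - g p.2| / `|p.1 - p.2|)%:E |
              p in `[0%R, 1%R] `*` `[0%R, 1%R]])%E.

Definition C11_norm (R : realType) (n : nat) (f : 'rV[R]_n -> R) : \bar R :=
  (ereal_sup [set `|f x|%:E | x in eball R n] +
   ereal_sup [set (enorm (grad f x))%:E | x in eball R n] +
   ereal_sup [set (enorm (grad f p.1 - grad f p.2) / enorm (p.1 - p.2))%:E |
              p in eball R n `*` eball R n])%E.

(* Functions on the whole of R^n: vanishing outside a compact subset of the ball
   makes f the extension by 0 of its restriction to the ball. *)
Definition C11c (R : realType) (n : nat) (f : 'rV[R]_n -> R) : Prop :=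
  let supp := closure [set x | f x != 0] in
  [/\ compact supp, supp `<=` eball R n,
      (forall x, eball R n x -> differentiable f x) &
      (C11_norm f < +oo)%E].

Fixpoint Ck_on (R : realType) (V : normedModType R) (k : nat) (U : set V)
    (f : V -> R) : Prop :=
  match k with
  | 0 => forall p, U p -> {for p, continuous f}
  | k'.+1 => (forall p, U p -> differentiable f p) /\
             (forall v : V, Ck_on k' U (fun p => 'D_v f p))
  end.

(* Smoothness on (0, oo) x R^n; values at times t <= 0 are unconstrained. *)
Definition smooth_pos (R : realType) (n : nat) (u : R -> 'rV[R]_n -> R) : Prop :=
  forall k : nat, Ck_on k [set p : R * 'rV[R]_n | 0 < p.1] (fun p => u p.1 p.2).

Definition dspace (R : realType) (n : nat) (e : 'rV[R]_n)
    (u : R -> 'rV[R]_n -> R) (t : R) (x : 'rV[R]_n) : R := 'D_e (u t) x.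

Definition parab (R : realType) (n : nat) (K : R -> 'rV[R]_n -> \bar R)
    (u : R -> 'rV[R]_n -> R) (t : R) (x : 'rV[R]_n) : R :=
  derive1 (fun r => u r x) t + LK (K t) (u t) x.

Definition pospart (R : realType) (a : R) : R := Num.max a 0.

(* Main.v *)
(* Fix t and x, write y = x - z, h = eta(t, x), d = h - eta(t, y), w = D_e u, p = q(x)
   with q = w or w_+, and subtract the right-hand side from the left.  The integrand
   becomes (Q - sigma (u(x) - u(y))^2) K with
     Q = - h^2 p^2 + 2 h^2 p w(y) - eta(t, y)^2 q(y)^2,
   up to a time term bounded by C h^(2-2s) p^2, since d(eta1^2)/dt is controlled by
   eta1^(2-2s) d(eta1^(2s))/dt.  If h p = 0 everything is nonpositive.  Otherwise split
   at the scale r = eps h with a radial Lipschitz cutoff psi.  For |z| <= 2r one has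
   Q <= 2 h d p^2 + 8 d^2 p^2, whose integral is at most C h^(2-2s) p^2 by the C^(1,1)
   bound on eta2.  For |z| >= r one has Q <= - h^2 p^2 + 2 h^2 p w(y): the first term
   yields the good term - c eps^(-2s) h^(2-2s) p^2, and in the second an integration by
   parts moves D_e onto psi K, after which Young's inequality absorbs it into the good
   term and sigma (u(x) - u(y))^2.  Choosing eps small makes the good term win, and
   sigma0 = C / eps^2. *)

Require Import Defs.
From mathcomp Require Import all_boot all_order all_algebra.
From mathcomp Require Import all_classical all_reals all_analysis.
From mathcomp Require Import measurable_realfun.
From mathcomp Require Import ring lra.

Set Implicit Arguments.
Unset Strict Implicit.
Unset Printing Implicit Defensive.

Import Order.TTheory GRing.Theory Num.Theory.
Import numFieldNormedType.Exports.

Local Open Scope classical_set_scope.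
Local Open Scope ring_scope.

(** * Euclidean norm *)

(** Only principal values are assumed, so nothing converges absolutely at the origin. The estimate
    is therefore proved for the truncated kernels [cut k rho] with constants free of [rho], and
    [rho] tends to 0 only at the end. No growth of [u] is known beyond the integrability of the
    truncated integrands. The cutoff thus also needs an outer radius [b]: integration by parts takes
    place on a bounded set, the rest is paid for by the tail of the integral of |w| k, and [b] tends
    to infinity while [rho] is fixed. The scale [r = eps * h] has three purposes. It keeps the
    points x - z with |z| <= 2r where eta2 is positive, hence inside the ball covered by the C^(1,1)
    bounds. It gives all competing terms the common size h^(2-2s) p^2. It turns the factor h^2 / r^2
    of Young's inequality into eps^(-2), so that sigma0 does not see h. Both inequalities are one
    statement about a function [Q], the identity or the positive part: all that is used is
    [Q y * z <= Q y * Q z], [Q y * y = Q y ^+ 2] and that [Q ^+ 2] has derivative [2 * Q]. *)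

Section euclidean_norm.
Context {R : realType} {n : nat}.
Implicit Types (x y : 'rV[R]_n) (a : R).

Lemma enorm_ge0 x : 0 <= enorm x.
Proof. exact: sqrtr_ge0. Qed.

Lemma enormE x : enorm x ^+ 2 = \sum_(i < n) x 0 i ^+ 2.
Proof. by rewrite sqr_sqrtr// sumr_ge0// => i _; exact: sqr_ge0. Qed.

Lemma enorm0 : enorm (0 : 'rV[R]_n) = 0.
Proof. by rewrite /enorm big1 ?sqrtr0// => i _; rewrite mxE expr0n. Qed.

Lemma enormZ a x : enorm (a *: x) = `|a| * enorm x.
Proof.
rewrite /enorm -sqrtr_sqr -sqrtrM ?sqr_ge0// mulr_sumr.
by congr Num.sqrt; apply: eq_bigr => i _; rewrite mxE exprMn.
Qed.

Lemma enormN x : enorm (- x) = enorm x.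
Proof. by rewrite -scaleN1r enormZ normrN1 mul1r. Qed.

Lemma enorm_distC x y : enorm (x - y) = enorm (y - x).
Proof. by rewrite -enormN opprB. Qed.

Lemma ler_coord_enorm x i : `|x 0 i| <= enorm x.
Proof.
rewrite -sqrtr_sqr ler_wsqrtr// (bigD1 i)//= lerDl sumr_ge0// => j _.
exact: sqr_ge0.
Qed.

Lemma enorm_eq0 x : (enorm x == 0) = (x == 0).
Proof.
apply/eqP/eqP => [x0|->]; last exact: enorm0.
apply/rowP => i; rewrite mxE; apply/eqP; rewrite -normr_le0 -x0.
exact: ler_coord_enorm.
Qed.

Lemma enorm_gt0 x : (0 < enorm x) = (x != 0).
Proof. by rewrite lt0r enorm_ge0 andbT enorm_eq0. Qed.

Lemma ler_dot_enorm x y : `|\sum_(i < n) x 0 i * y 0 i| <= enorm x * enorm y.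
Proof.
wlog suff H : x / \sum_(i < n) x 0 i * y 0 i <= enorm x * enorm y.
  rewrite ler_norml H// andbT lerNl -sumrN.
  rewrite (eq_bigr (fun i => (- x) 0 i * y 0 i)); last first.
    by move=> i _; rewrite mxE mulNr.
  by rewrite -(enormN x).
have [x0|x0] := eqVneq x 0.
  by rewrite x0 enorm0 mul0r big1// => i _; rewrite mxE mul0r.
have [y0|y0] := eqVneq y 0.
  by rewrite y0 enorm0 mulr0 big1// => i _; rewrite mxE mulr0.
have a0 : 0 < enorm x by rewrite enorm_gt0.
have b0 : 0 < enorm y by rewrite enorm_gt0.
have : 0 <= \sum_(i < n) (x 0 i * enorm y - y 0 i * enorm x) ^+ 2.
  by apply: sumr_ge0 => i _; exact: sqr_ge0.
rewrite (eq_bigr (fun i => (enorm y ^+ 2 * x 0 i ^+ 2 +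
    enorm x ^+ 2 * y 0 i ^+ 2) - 2 * (enorm x * enorm y) * (x 0 i * y 0 i))); last first.
  by move=> i _; ring.
rewrite sumrB big_split/= -!mulr_sumr -!enormE.
have ab := mulr_gt0 a0 b0.
rewrite (_ : _ - _ = 2 * (enorm x * enorm y) *
  (enorm x * enorm y - \sum_(i < n) x 0 i * y 0 i)); last by ring.
by rewrite pmulr_rge0 ?subr_ge0// mulr_gt0.
Qed.

Lemma ler_enormD x y : enorm (x + y) <= enorm x + enorm y.
Proof.
rewrite -(ler_pXn2r (_ : 0 < 2)%N)// ?nnegrE ?addr_ge0 ?enorm_ge0//.
rewrite enormE (eq_bigr (fun i => x 0 i ^+ 2 + y 0 i ^+ 2 + 2 * (x 0 i * y 0 i))).
  rewrite !big_split/= -!enormE -mulr_sumr.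
  have := le_trans (ler_norm _) (ler_dot_enorm x y).
  by move=> h; rewrite sqrrD -mulr_natl; lra.
by move=> i _; rewrite mxE; ring.
Qed.

Lemma ler_enorm_distD x y : enorm x <= enorm (x - y) + enorm y.
Proof. by rewrite -[X in enorm X <= _](subrK y) ler_enormD. Qed.

Lemma ler_dist_enorm x y : `|enorm x - enorm y| <= enorm (x - y).
Proof.
rewrite ler_norml lerNl opprB !lerBlDr ler_enorm_distD andbT enorm_distC.
exact: ler_enorm_distD.
Qed.

Lemma ler_norm_enorm x : `|x| <= enorm x.
Proof.
rewrite [leLHS]mx_normrE; apply/bigmax_leP; split=> [|[i j] _/=].
  exact: enorm_ge0.
by rewrite ord1 ler_coord_enorm.
Qed.

Lemma ler_enorm_coord x (c : R) : 0 <= c -> (forall i, `|x 0 i| <= c) ->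
  enorm x <= Num.sqrt n%:R * c.
Proof.
move=> c0 xc; rewrite -[c in leRHS]ger0_norm// -sqrtr_sqr -sqrtrM ?ler0n//.
rewrite ler_wsqrtr// mulr_natl -[n in X in _ <= X]card_ord -sumr_const.
apply: ler_sum => i _; rewrite -real_normK ?num_real//.
by rewrite lerXn2r// ?nnegrE.
Qed.

Lemma ler_enorm_norm x : enorm x <= Num.sqrt n%:R * `|x|.
Proof.
apply: ler_enorm_coord => // i; rewrite [leRHS]mx_normrE.
by apply: (le_bigmax _ _ (0, i)).
Qed.

(** Entry point of Euclidean estimates into the library topology, which comes from the sup norm. The
    [+ 1] in the proof keeps the constant positive when [n = 0]. *)
Lemma near_enorm x e : 0 < e -> \forall y \near x, enorm (x - y) < e.
Proof.
move=> e0; have c0 : 0 < Num.sqrt n%:R + 1 :> R by rewrite ltr_wpDl// sqrtr_ge0.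
have d0 : 0 < e / (Num.sqrt n%:R + 1) by rewrite divr_gt0.
have : \forall y \near x, `|x - y| < e / (Num.sqrt n%:R + 1).
  by apply/nbhs_normP; exists (e / (Num.sqrt n%:R + 1)).
apply: filterS => y; rewrite ltr_pdivlMr// => xy.
apply: le_lt_trans (ler_enorm_norm _) _; apply: le_lt_trans xy.
by rewrite mulrC ler_wpM2l// lerDl.
Qed.

Lemma continuous_enorm : continuous (@enorm R n).
Proof.
move=> x; apply/(@cvgrPdist_lt _ _ _ (nbhs x) (nbhs_filter x)) => e e0.
apply: filterS (near_enorm x e0) => y; apply: le_lt_trans.
exact: ler_dist_enorm.
Qed.

Lemma continuous_rVB x : continuous (fun y : 'rV[R]_n => x - y).
Proof.
by move=> y; apply: (@continuousB _ _ _ (cst x) id); [exact: cst_continuous|].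
Qed.

Lemma compact_enorm_le (x : 'rV[R]_n) (c : R) : compact [set y | enorm (x - y) <= c].
Proof.
apply: bounded_closed_compact.
  exists (`|x| + c); split; first exact: num_real.
  move=> M Mc y /= yc.
  have -> : y = x - (x - y) by rewrite opprB addrC subrK.
  apply: le_trans (ltW Mc); rewrite (le_trans (ler_normB _ _))// lerD2l.
  exact: le_trans (ler_norm_enorm _) _.
have : continuous (fun y => enorm (x - y)).
  by move=> y; apply: continuous_comp; [exact: continuous_rVB|exact: continuous_enorm].
by move=> cf; apply: (closed_comp _ (@closed_le _ c)) => y _; exact: cf.
Qed.

End euclidean_norm.

(** * Lebesgue measure on R^n *)

Section tuple_measurability.
Context {R : realType}.

(** The sigma-algebra on tuples is generated by the coordinates, so open sets have to be recovered:
    each is the union of the countably many cubes with rational centre and half-width 1/(m+1) that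
    it contains. *)
Lemma measurable_rV_open n (O : set 'rV[R]_n) : open O ->
  measurable (@rV_of_tuple R n @^-1` O).
Proof.
move=> oO.
pose C (q : 'rV[rat]_n * nat) : set 'rV[R]_n :=
  [set y | forall i, `|y 0 i - ratr (q.1 0 i)| < q.2.+1%:R^-1].
pose B q := if asbool (C q `<=` O) then C q else set0.
have -> : O = \bigcup_q B q.
  apply/seteqP; split => [x Ox|x [q _]]; last first.
    by rewrite /B; case: asboolP => // CO; exact: CO.
  have [e /= e0 eO] : nbhs_ball x O.
    by rewrite nbhs_ballE; move: oO; rewrite openE; exact.
  have [m me] : exists m : nat, m.+1%:R^-1 < e / 2.
    near \oo => m; exists m; near: m.
    exact: near_infty_natSinv_lt (PosNum (divr_gt0 e0 (ltr0Sn _ 1))).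
  have m0 : 0 < m.+1%:R^-1 :> R by rewrite invr_gt0.
  have /choice[q hq] : forall i : 'I_n, exists r : rat,
      `|x 0 i - ratr r| < m.+1%:R^-1.
    move=> i; have : x 0 i - m.+1%:R^-1 < x 0 i + m.+1%:R^-1.
      by rewrite ltrD2l gtrN.
    move=> /rat_in_itvoo[r]; rewrite in_itv/= => /andP[r1 r2].
    by exists r; rewrite ltr_distlC r1 r2.
  exists (\row_i q i, m) => //; rewrite /B; case: asboolP => [_ i|/= []].
    by rewrite mxE.
  move=> y /= hy; apply: eO; split=> // i j; rewrite ord1 /ball/=.
  have := hy j; rewrite mxE => hyj.
  rewrite -(subrK (ratr (q j)) (x 0 j)) -addrA.
  apply: le_lt_trans (ler_normD _ _) _; rewrite [e]splitr ltrD//.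
    exact: lt_trans (hq j) me.
  by rewrite distrC (lt_trans hyj).
rewrite preimage_bigcup; apply: countable_bigcupT_measurable => //.
move=> q; rewrite /B; case: asboolP => _; last by rewrite preimage_set0.
rewrite (_ : _ @^-1` _ = \bigcap_(i in setT) ((@tnth n R)^~ i @^-1`
   [set y | `|y - ratr (q.1 0 i)| < q.2.+1%:R^-1])).
  apply: fin_bigcap_measurable => // i _.
  rewrite -[X in measurable X]setTI; apply: measurable_tnth => //.
  rewrite (_ : [set y | _] = ball (ratr (q.1 0 i) : R) q.2.+1%:R^-1).
    apply: open_measurable; exact: ball_open.
  by apply/seteqP; split => y; rewrite /ball/= distrC.
by apply/seteqP; split => z /= h i; have := h i; rewrite !mxE; [move=> + _|move/(_ I)].
Unshelve. all: by end_near. Qed.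

Lemma measurable_rV_closed n (O : set 'rV[R]_n) : closed O ->
  measurable (@rV_of_tuple R n @^-1` O).
Proof.
move=> cO; rewrite -[X in measurable X]setCK preimage_setC.
by apply: measurableC; apply: measurable_rV_open; exact: closed_openC.
Qed.

Lemma measurable_fun_rV n (U : set 'rV[R]_n) (f : 'rV[R]_n -> R) :
  open U -> {in U, continuous f} ->
  measurable_fun (@rV_of_tuple R n @^-1` U) (f \o @rV_of_tuple R n).
Proof.
move=> oU cf; apply: (measurability _ (RGenOpens.measurableE R)).
move=> /= _ [_ [a [b ->] <-]].
apply: (@measurable_rV_open n (U `&` f @^-1` `]a, b[%classic)).
rewrite openE => x [Ux fx]; apply: filterI; first by move: oU; rewrite openE; exact.
by apply: cf; [rewrite inE|exact: interval_open].
Qed.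

Lemma measurable_funT_rV n (f : 'rV[R]_n -> R) : continuous f ->
  measurable_fun setT (f \o @rV_of_tuple R n).
Proof.
move=> cf; rewrite -[setT](preimage_setT (@rV_of_tuple R n)).
by apply: measurable_fun_rV => //; exact: openT.
Qed.

End tuple_measurability.

Local Notation pushforward_measure :=
  measure_function_pushforward__canonical__measure_function_Measure.

(** * Invariance of Lebesgue measure under translations and reflections *)

Section affine_invariance.
Context {R : realType}.

Definition affine_tuple n (c : R) (a : 'rV[R]_n) (z : n.-tuple R) : n.-tuple R :=
  [tuple c * tnth z i + a 0 i | i < n].

Lemma rV_affine_tuple n c (a : 'rV[R]_n) z :
  rV_of_tuple (affine_tuple c a z) = c *: rV_of_tuple z + a.
Proof. by apply/rowP => i; rewrite !mxE tnth_mktuple. Qed.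

Lemma measurable_affine_tuple n c (a : 'rV[R]_n) :
  measurable_fun setT (affine_tuple c a).
Proof.
apply/measurable_fun_tnthP => i.
rewrite (_ : _ \o _ = fun z => c * tnth z i + a 0 i).
  apply: measurable_funD => //; apply: measurable_funM => //.
  exact: measurable_tnth.
by apply/funext => z /=; rewrite tnth_mktuple.
Qed.

Lemma lebesgue_measure_affine (c a : R) (A : set R) : `|c| = 1 ->
  measurable A -> lebesgue_measure ((fun x => c * x + a) @^-1` A) =
  lebesgue_measure A.
Proof.
move=> c1 mA.
have mf : @measurable_fun _ _ (measurableTypeR R) (measurableTypeR R) setT
    (fun x => c * x + a).
  by apply: measurable_funD => //; exact: measurable_funM.
rewrite [RHS](@lebesgue_measure_unique _ (pushforward_measure lebesgue_measure mf))//.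
move=> _ /= [[l r] _ <-] /=; rewrite /pushforward.
have [->|->] : c = 1 \/ c = -1.
  by have /eqP := c1; rewrite eqr_norml ler01 andbT => /orP[]/eqP; [left|right].
  rewrite (_ : _ @^-1` _ = `](l - a), (r - a)]%classic); last first.
    by apply/seteqP; split => x /=; rewrite !in_itv/= mul1r ltrBlDr lerBrDr.
  rewrite !lebesgue_measure_itv/= !lte_fin ltrD2r; case: ifP => // _.
  by rewrite -!EFinD; congr (_%:E); ring.
(* Reflection exchanges the open and the closed end; the length is unaffected. *)
rewrite (_ : _ @^-1` _ = `[(a - r), (a - l)[%classic); last first.
  apply/seteqP; split => x /=; rewrite !in_itv/= mulN1r => /andP[h1 h2];
  by apply/andP; split; lra.
rewrite !lebesgue_measure_itv/= !lte_fin ltrD2l ltrN2; case: ifP => // _.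
by rewrite -!EFinD; congr (_%:E); ring.
Qed.

(** Induction on the dimension: the map acts separately on head and tail, and the image of the
    product measure agrees with that measure on rectangles, so uniqueness of product measures
    applies. The case c = -1 serves y = x - z and z -> -z, the case c = 1 serves translations. *)
Lemma lebesgue_tuple_affine n (c : R) (a : 'rV[R]_n) (A : set (n.-tuple R)) :
  `|c| = 1 -> measurable A ->
  lebesgue_tuple R n (affine_tuple c a @^-1` A) = lebesgue_tuple R n A.
Proof.
move=> c1; elim: n a A => [|n IHn] a A mA.
  by congr (lebesgue_tuple R 0 _); apply/seteqP; split => z /=; rewrite (tuple0 z) [affine_tuple _ _ _]tuple0.
pose a' : 'rV[R]_n := \row_i a 0 (lift ord0 i).
pose T (p : R * n.-tuple R) := (c * p.1 + a 0 ord0, affine_tuple c a' p.2).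
have mT : @measurable_fun _ _ (measurableTypeR R * n.-tuple R)%type
    (measurableTypeR R * n.-tuple R)%type setT T.
  apply: measurable_fun_pair.
    by apply: measurable_funD => //; exact: measurable_funM.
  apply: (@measurableT_comp _ _ _ _ _ _ (affine_tuple c a')) => //.
  exact: measurable_affine_tuple.
rewrite /= /tcons_measure /pushforward.
have mA' : measurable (@tcons R n @^-1` A).
  by rewrite -[X in measurable X]setTI; exact: measurable_tcons.
have := @product_measure_unique _ _ _ _ _ lebesgue_measure (lebesgue_tuple R n)
  (pushforward_measure (lebesgue_measure \x lebesgue_tuple R n)%E mT).
move=> /(_ _ _ mA') => ->.
  rewrite /pushforward; congr (product_measure1 _ _ _).
  apply/seteqP; split => -[x z] /=.
    move=> Az; rewrite (_ : tcons _ = affine_tuple c a (tcons (x, z)))//.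
    apply: eq_from_tnth => i; rewrite tnth_mktuple.
    by case: (unliftP ord0 i) => [j ->|->]; rewrite ?tnthS ?tnth_mktuple ?mxE ?tnthS.
  move=> Az; rewrite (_ : affine_tuple _ _ _ = tcons (T (x, z)))//.
  apply: eq_from_tnth => i; rewrite tnth_mktuple.
  by case: (unliftP ord0 i) => [j ->|->]; rewrite ?tnthS ?tnth_mktuple ?mxE ?tnthS.
move=> B C mB mC.
have E : T @^-1` (B `*` C) = ((fun x => c * x + a 0 ord0) @^-1` B) `*`
    (affine_tuple c a' @^-1` C) by apply/seteqP; split => -[x z].
rewrite -[LHS]/((lebesgue_measure \x lebesgue_tuple R n)%E (T @^-1` (B `*` C))) E.
rewrite product_measure1E//=.
- by rewrite lebesgue_measure_affine// IHn.
- rewrite -[X in measurable X]setTI.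
  have : measurable_fun setT (fun x : measurableTypeR R => c * x + a 0 ord0).
    by apply: measurable_funD => //; exact: measurable_funM.
  exact.
- by rewrite -[X in measurable X]setTI; exact: measurable_affine_tuple.
Qed.

Lemma ge0_integral_affine n (c : R) (a : 'rV[R]_n) (f : n.-tuple R -> \bar R) :
  `|c| = 1 -> measurable_fun setT f -> (forall z, (0 <= f z)%E) ->
  (\int[lebesgue_tuple R n]_z f (affine_tuple c a z) =
   \int[lebesgue_tuple R n]_z f z)%E.
Proof.
move=> c1 mf f0.
rewrite -(@ge0_integral_pushforward _ _ _ _ _ _
  (measurable_affine_tuple c a) (lebesgue_tuple R n) setT f)//.
apply: (@eq_measure_integral _ _ _ _ (lebesgue_tuple R n) (pushforward_measure
  (lebesgue_tuple R n) (measurable_affine_tuple c a))) => A mA _.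
exact: lebesgue_tuple_affine.
Qed.

End affine_invariance.

(** * Integrals of functions of row vectors *)

Section rV_integral.
Context {R : realType} {n : nat}.
Notation mu := (lebesgue_tuple R n).
Implicit Types (f g : 'rV[R]_n -> R) (c r : R).

(** Calculus takes place on row vectors and the measure lives on tuples; these three definitions let
    the estimates speak of functions on row vectors only. *)
Definition rV_measurable f := measurable_fun setT (f \o @rV_of_tuple R n).
Definition rV_integrable f := mu.-integrable setT (EFin \o (f \o @rV_of_tuple R n)).
Definition rV_int f : R := \int[mu]_z f (rV_of_tuple z).

Lemma rV_integrable_measurable f : rV_integrable f -> rV_measurable f.
Proof. by move=> /integrableP[/measurable_EFinP]. Qed.

Lemma eq_rV_integrable f g : f =1 g -> rV_integrable f -> rV_integrable g.
Proof. by move=> /funext ->. Qed.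

Lemma rV_integrable_le f g : rV_measurable f -> (forall x, `|f x| <= g x) ->
  rV_integrable g -> rV_integrable f.
Proof.
move=> mf fg ig; apply: (le_integrable measurableT _ _ ig).
  exact/measurable_EFinP.
move=> z _ /=; rewrite lee_fin; apply: le_trans (fg _) _; exact: ler_norm.
Qed.

Lemma rV_integrableD f g : rV_integrable f -> rV_integrable g ->
  rV_integrable (fun x => f x + g x).
Proof.
move=> if_ ig; have := integrableD measurableT if_ ig.
by apply: eq_integrable.
Qed.

Lemma rV_integrableZ c f : rV_integrable f -> rV_integrable (fun x => c * f x).
Proof.
move=> if_; have := integrableZl measurableT c if_.
by apply: eq_integrable.
Qed.

Lemma rV_integrableB f g : rV_integrable f -> rV_integrable g ->
  rV_integrable (fun x => f x - g x).
Proof.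
move=> if_ ig; have := integrableB measurableT if_ ig.
by apply: eq_integrable.
Qed.

Lemma rV_intD f g : rV_integrable f -> rV_integrable g ->
  rV_int (fun x => f x + g x) = rV_int f + rV_int g.
Proof. by move=> if_ ig; rewrite /rV_int RintegralD. Qed.

Lemma rV_intB f g : rV_integrable f -> rV_integrable g ->
  rV_int (fun x => f x - g x) = rV_int f - rV_int g.
Proof. by move=> if_ ig; rewrite /rV_int RintegralB. Qed.

Lemma rV_intZ c f : rV_integrable f ->
  rV_int (fun x => c * f x) = c * rV_int f.
Proof. by move=> if_; rewrite /rV_int RintegralZl. Qed.

Lemma le_rV_int f g : rV_integrable f -> rV_integrable g ->
  (forall x, f x <= g x) -> rV_int f <= rV_int g.
Proof. by move=> if_ ig fg; apply: le_Rintegral. Qed.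

Lemma ler_norm_rV_int f g : rV_integrable f -> rV_integrable g ->
  (forall x, `|f x| <= g x) -> `|rV_int f| <= rV_int g.
Proof.
move=> if_ ig fg; apply: le_trans (le_normr_Rintegral measurableT if_) _.
have ifn : rV_integrable (fun x => `|f x|).
  apply: rV_integrable_le ig => [|x]; last by rewrite normr_id.
  by apply: measurableT_comp => //; exact: rV_integrable_measurable.
exact: (le_rV_int ifn ig).
Qed.

Lemma rV_int_le_bound f c : rV_measurable f -> (forall x, 0 <= f x) ->
  (\int[mu]_z (f (rV_of_tuple z))%:E <= c%:E)%E ->
  rV_integrable f /\ rV_int f <= c.
Proof.
move=> mf f0 fc; split.
  apply/integrableP; split; first exact/measurable_EFinP.
  rewrite (eq_integral (fun z => (f (rV_of_tuple z))%:E)); last first.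
    by move=> z _ /=; rewrite ger0_norm.
  exact: le_lt_trans fc (ltry _).
rewrite /rV_int /Rintegral -lee_fin fineK//.
rewrite ge0_fin_numE ?(le_lt_trans fc) ?ltry//.
by apply: integral_ge0 => z _; rewrite lee_fin.
Qed.

Lemma rV_measurable_affine c (a : 'rV[R]_n) f : rV_measurable f ->
  rV_measurable (fun x => f (c *: x + a)).
Proof.
move=> mf; rewrite /rV_measurable.
rewrite (_ : _ \o _ = (f \o @rV_of_tuple R n) \o affine_tuple c a).
  by apply: measurableT_comp => //; exact: measurable_affine_tuple.
by apply/funext => z /=; rewrite rV_affine_tuple.
Qed.

Lemma rV_integrable_affine c (a : 'rV[R]_n) f : `|c| = 1 -> rV_integrable f ->
  rV_integrable (fun x => f (c *: x + a)).
Proof.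
move=> c1 if_; have mf := rV_integrable_measurable if_.
move/integrableP : if_ => [mf' fy]; apply/integrableP; split.
  by apply/measurable_EFinP; exact: (rV_measurable_affine c a mf).
apply: le_lt_trans fy; 
rewrite -(ge0_integral_affine (f := fun z => `|(f (rV_of_tuple z))%:E|%E) a c1)//; last first.
  exact: measurableT_comp.
rewrite le_eqVlt; apply/orP; left; apply/eqP.
by apply: eq_integral => z _; rewrite /= rV_affine_tuple.
Qed.

Lemma rV_int_affine c (a : 'rV[R]_n) f : `|c| = 1 -> rV_integrable f ->
  rV_int (fun x => f (c *: x + a)) = rV_int f.
Proof.
move=> c1 if_; have mf := rV_integrable_measurable if_.
have if' := rV_integrable_affine a c1 if_.
rewrite /rV_int /Rintegral; congr fine.
rewrite (eq_integral ((EFin \o (f \o @rV_of_tuple R n)) \o affine_tuple c a)); last first.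
  by move=> z _; rewrite /= rV_affine_tuple.
rewrite -(@integral_pushforward _ _ _ _ _ _ (measurable_affine_tuple c a)
  (lebesgue_tuple R n) setT)//.
- apply: (@eq_measure_integral _ _ _ _ (lebesgue_tuple R n)
    (pushforward_measure (lebesgue_tuple R n) (measurable_affine_tuple c a))).
  by move=> A mA _; exact: lebesgue_tuple_affine.
- exact/measurable_EFinP.
- rewrite preimage_setT; apply: eq_integrable if' => // z _.
  by rewrite /= rV_affine_tuple.
Qed.

Lemma lebesgue_tuple_cube (a b : R) : a <= b ->
  mu [set z | forall i, tnth z i \in `[a, b]] = ((b - a) ^+ n)%:E.
Proof.
move=> ab; rewrite (lebesgue_tuple_box (A := fun=> `[a, b]%classic))//.
rewrite (eq_bigr (fun=> (b - a)%:E)).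
  by rewrite prodEFin prodr_const card_ord.
move=> i _; rewrite lebesgue_measure_itv/= lte_fin.
move: ab; rewrite le_eqVlt => /predU1P[<-|ab]; first by rewrite ltxx subrr.
by rewrite ab EFinB.
Qed.

Lemma measurable_cube (a b : R) :
  measurable [set z : n.-tuple R | forall i, tnth z i \in `[a, b]].
Proof.
rewrite (_ : [set _ | _] = \bigcap_(i in setT) ((@tnth n R)^~ i @^-1` `[a, b]%classic)).
  apply: fin_bigcap_measurable => // i _.
  by rewrite -[X in measurable X]setTI; apply: measurable_tnth.
by apply/seteqP; split => z /= h i; [move=> _|]; apply: h.
Qed.

Definition ball_tuple (b : R) : set (n.-tuple R) :=
  [set z | enorm (rV_of_tuple z) <= b].

Lemma measurable_ball_tuple b : measurable (ball_tuple b).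
Proof.
apply: (@measurable_rV_closed _ _ [set x | enorm x <= b]).
by apply: (closed_comp _ (@closed_le _ b)) => y _; exact: continuous_enorm.
Qed.

(** The ball sits in a cube of explicit measure; a factor depending on [n] is harmless in all later
    constants. *)
Lemma lebesgue_ball_tuple b : 0 <= b ->
  (mu (ball_tuple b) <= ((2 * b) ^+ n)%:E)%E.
Proof.
move=> b0; have bb : - b <= b by lra.
rewrite (_ : 2 * b = b - (- b)); last by ring.
rewrite -lebesgue_tuple_cube//; apply: le_measure; rewrite ?inE//.
- exact: measurable_ball_tuple.
- exact: measurable_cube.
move=> z /= zb i; rewrite in_itv/= -ler_norml.
by apply: le_trans zb; have := ler_coord_enorm (rV_of_tuple z) i; rewrite mxE.
Qed.

Lemma rV_measurable_restrict f b : rV_measurable f ->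
  rV_measurable (fun x => if enorm x <= b then f x else 0).
Proof.
move=> mf; have := (measurable_restrictT (f \o @rV_of_tuple R n)
  (measurable_ball_tuple b)).1 (measurable_funTS mf).
rewrite /rV_measurable; congr measurable_fun; apply/funext => z.
rewrite patchE /=; case: leP => zb; first by rewrite mem_set.
by rewrite memNset//= /ball_tuple/=; apply/negP; rewrite -ltNge.
Qed.

Lemma rV_measurableB f g : rV_measurable f -> rV_measurable g ->
  rV_measurable (fun x => f x - g x).
Proof. by move=> mf mg; exact: (measurable_funB mf mg). Qed.

Lemma rV_measurableM f g : rV_measurable f -> rV_measurable g ->
  rV_measurable (fun x => f x * g x).
Proof. by move=> mf mg; exact: (measurable_funM mf mg). Qed.

Lemma rV_int_lin f g c : rV_integrable f -> rV_integrable g ->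
  rV_integrable (fun x => f x + c * g x) /\
  rV_int (fun x => f x + c * g x) = rV_int f + c * rV_int g.
Proof.
move=> if_ ig; have ic := rV_integrableZ c ig.
by split; [exact: rV_integrableD|rewrite rV_intD// rV_intZ].
Qed.

(* The balls of radii b j need not be disjoint: f is dominated by the sum of the
   M j times their indicators. *)
Lemma dyadic_integral_le f (b M : nat -> R) c q :
  rV_measurable f -> (forall x, 0 <= f x) -> 0 <= q < 1 ->
  (forall j, 0 <= b j) -> (forall j, 0 <= M j) ->
  (forall x, f x != 0 -> exists2 j, enorm x <= b j & f x <= M j) ->
  (forall j, M j * (2 * b j) ^+ n <= c * q ^+ j) ->
  rV_integrable f /\ rV_int f <= c / (1 - q).
Proof.
move=> mf f0 /andP[q0 q1] b0 M0 fM Mc; apply: rV_int_le_bound => //.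
have q10 : 0 < 1 - q by rewrite subr_gt0.
pose h j (z : n.-tuple R) : \bar R := (M j * \1_(ball_tuple (b j)) z)%:E.
have mh j : measurable_fun setT (h j).
  apply/measurable_EFinP; apply: measurable_funM => //.
  exact: (measurable_indic (measurable_ball_tuple _)).
have h0 j z : (0 <= h j z)%E by rewrite lee_fin mulr_ge0.
apply: (@le_trans _ _ (\int[mu]_z (\sum_(j <oo) h j z)))%E.
  apply: ge0_le_integral => //.
  - by move=> z _; rewrite lee_fin.
  - exact/measurable_EFinP.
  - by apply: ge0_emeasurable_sum => //.
  move=> z _; have [->|fz] := eqVneq (f (rV_of_tuple z)) 0.
    by apply: nneseries_ge0.
  have [j zj fj] := fM _ fz.
  apply: (@le_trans _ _ (\sum_(0 <= i < j.+1) h i z)%E); last first.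
    exact: nneseries_lim_ge.
  rewrite big_nat_recr//=; apply: (@le_trans _ _ (h j z)).
    by rewrite /h indicE mem_set// mulr1 lee_fin.
  by rewrite leeDr// sume_ge0.
rewrite integral_nneseries//; apply: lime_le.
  by apply: is_cvg_nneseries => *; apply: integral_ge0.
near=> m.
apply: (@le_trans _ _ (\sum_(0 <= j < m) (c * q ^+ j))%:E).
  rewrite -sumEFin; apply: lee_sum => j _; rewrite /h.
  under eq_integral do rewrite EFinM.
  have mi : measurable_fun setT (EFin \o \1_(ball_tuple (b j)) : n.-tuple R -> \bar R).
    by apply/measurable_EFinP; exact: (measurable_indic (measurable_ball_tuple _)).
  rewrite ge0_integralZl//; last by rewrite lee_fin.
  rewrite integral_indic//; last exact: measurable_ball_tuple.
  rewrite setIT; apply: le_trans (_ : _ <= (M j)%:E * ((2 * b j) ^+ n)%:E)%E _.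
    by rewrite lee_wpmul2l ?lee_fin//; exact: lebesgue_ball_tuple.
  by rewrite -EFinM lee_fin.
have c0 : 0 <= c.
  by have := Mc 0%N; rewrite expr0 mulr1; apply: le_trans; rewrite mulr_ge0// exprn_ge0// mulr_ge0.
rewrite lee_fin -mulr_sumr ler_wpM2l//.
(* Geometric sum: (1 - q)(1 + ... + q^(m-1)) = 1 - q^m <= 1. *)
rewrite -[leRHS]mul1r ler_pdivlMr// mulrC big_mkord -[1 - q]opprB mulNr -subrX1.
by rewrite opprB gerBl exprn_ge0.
Unshelve. all: by end_near. Qed.

End rV_integral.

(** * Kernel integrals *)

Lemma dyadic_bracket {R : realType} (x : R) : 1 <= x ->
  exists j : nat, 2 ^+ j <= x < 2 ^+ j.+1.
Proof.
move=> x1.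
have ex : exists m : nat, x < 2 ^+ m.
  exists (Num.bound x); apply: lt_le_trans (archi_boundP (le_trans ler01 x1)) _.
  by rewrite -natrX ler_nat ltnW// ltn_expl.
case: (ex_minnP ex) => -[|j] xj jmin.
  by move: xj; rewrite expr0 ltNge x1.
exists j; rewrite xj andbT leNgt; apply/negP => /jmin.
by rewrite ltnn.
Qed.

Section powR_decay.
Context {R : realType}.
Implicit Types (a b s r : R).

Lemma le0_ler_powR r a b : r <= 0 -> 0 < a -> a <= b -> b `^ r <= a `^ r.
Proof.
move=> r0 a0 ab; have b0 := lt_le_trans a0 ab.
have [t [t0 ->]] : exists t, 0 <= t /\ r = - t.
  by exists (- r); rewrite oppr_ge0 opprK.
rewrite !powRN lef_pV2 ?posrE ?powR_gt0//.
by rewrite ge0_ler_powR ?nnegrE// ltW.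
Qed.

Lemma powR_exprn r a (j : nat) : 0 <= a -> (a ^+ j) `^ r = (a `^ r) ^+ j.
Proof.
by move=> a0; rewrite -(powR_mulrn j a0) -(powR_mulrn j (powR_ge0 _ _)) powRAC.
Qed.

Lemma powR_V r a : 0 <= a -> a^-1 `^ r = (a `^ r)^-1.
Proof. by move=> a0; rewrite -powR_inv1// powRAC powR_inv1// powR_ge0. Qed.

Lemma expr_powRN (n : nat) s a : 0 < a ->
  a ^+ n * a `^ (- n%:R - 2 * s) = a `^ (- (2 * s)).
Proof.
move=> a0; rewrite -powR_mulrn ?ltW// -powRD; last first.
  by apply/implyP => _; rewrite gt_eqF.
by congr (_ `^ _); ring.
Qed.

Lemma expr2_powRN s a : 0 < a -> a ^+ 2 * a `^ (- (2 * s)) = a `^ (2 - 2 * s).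
Proof.
move=> a0; rewrite -powR_mulrn ?ltW// -powRD; last first.
  by apply/implyP => _; rewrite gt_eqF.
by [].
Qed.

Lemma powR_lt1 a r : 0 < a < 1 -> 0 < r -> a `^ r < 1.
Proof.
move=> /andP[a0 a1] r0; rewrite (_ : 1 = 1 `^ r); last by rewrite powR1.
by rewrite gt0_ltr_powR ?nnegrE// ltW.
Qed.

End powR_decay.

Section kernel.
Context {R : realType} (n : nat) (s lam Lam : R).
Hypotheses (s01 : 0 < s < 1) (lam0 : 0 < lam) (lamL : lam <= Lam).

(** The class [Ls1] for a real-valued kernel, to be applied to [fine \o K]. The value at 0, where
    [K] may be infinite, is left free. *)
Definition kernel_bounds (k : 'rV[R]_n -> R) : Prop :=
  (forall y, k (- y) = k y) /\
  forall y, y != 0 ->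
    [/\ lam * enorm y `^ (- n%:R - 2 * s) <= k y,
        k y <= Lam * enorm y `^ (- n%:R - 2 * s),
        differentiable k y &
        enorm (grad k y) <= Lam * (enorm y)^-1 * k y].

(** The sphere of radius [rho] is kept, as in [off_ball], so that [LK_trunc] is exactly an integral
    against [cut]. *)
Definition cut (k : 'rV[R]_n -> R) (rho : R) (z : 'rV[R]_n) : R :=
  if enorm z < rho then 0 else k z.

Let Lam0 : 0 < Lam. Proof. exact: lt_le_trans lamL. Qed.
Let s0 : 0 < s. Proof. by case/andP : s01. Qed.
Let s1 : s < 1. Proof. by case/andP : s01. Qed.
Let expo_le0 : - n%:R - 2 * s <= 0.
Proof. by have := ler0n R n; have := s0; lra. Qed.

Lemma kernel_gt0 k z : kernel_bounds k -> z != 0 -> 0 < k z.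
Proof.
move=> [_ kb] z0; have [kl _ _ _] := kb _ z0.
by apply: lt_le_trans kl; rewrite mulr_gt0// powR_gt0// enorm_gt0.
Qed.

Lemma cut_ge0 k rho z : kernel_bounds k -> 0 < rho -> 0 <= cut k rho z.
Proof.
move=> kb rho0; rewrite /cut; case: ltP => // zr.
by apply/ltW/(kernel_gt0 kb); rewrite -enorm_gt0 (lt_le_trans rho0).
Qed.

Lemma cutN k rho z : kernel_bounds k -> cut k rho (- z) = cut k rho z.
Proof. by move=> [kN _]; rewrite /cut enormN kN. Qed.

Lemma cut_le k rho z : kernel_bounds k -> 0 < rho -> rho <= enorm z ->
  cut k rho z <= Lam * enorm z `^ (- n%:R - 2 * s).
Proof.
move=> [_ kb] rho0 zr; rewrite /cut ltNge zr/=.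
by have [] := kb z _; rewrite -?enorm_gt0 ?(lt_le_trans rho0).
Qed.

Lemma cut_measurable k rho : kernel_bounds k -> 0 < rho ->
  rV_measurable (cut k rho).
Proof.
move=> kb rho0.
pose D := [set z : n.-tuple R | rho <= enorm (rV_of_tuple z)].
have mD : measurable D.
  apply: (@measurable_rV_closed _ _ [set x | rho <= enorm x]).
  by apply: (closed_comp _ (@closed_ge _ rho)) => y _; exact: continuous_enorm.
have : measurable_fun D (k \o @rV_of_tuple R n).
  have oU : open [set x : 'rV[R]_n | 0 < enorm x].
    by apply: (open_comp _ (@open_gt _ 0)) => y _; exact: continuous_enorm.
  apply: (@measurable_funS _ _ _ _ (@rV_of_tuple R n @^-1` [set x | 0 < enorm x])).
  - exact: measurable_rV_open.
  - by move=> z; exact: lt_le_trans.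
  apply: measurable_fun_rV => // x; rewrite inE/= enorm_gt0 => x0.
  apply: differentiable_continuous; by have [] := kb.2 _ x0.
move=> /(measurable_restrictT _ mD).1.
rewrite /rV_measurable (_ : _ \_ _ = cut k rho \o @rV_of_tuple R n)//.
apply/funext => z; rewrite patchE /cut /=; case: ltP => zr.
  by rewrite memNset//= /D/=; apply/negP; rewrite -ltNge.
by rewrite mem_set.
Qed.

(** On the shell from rho 2^j to rho 2^(j+1) the kernel is at most Lam (rho 2^j)^(-n-2s) and the
    volume is of order (rho 2^j)^n, so the bounds decay with ratio 2^(-2s), which is where s > 0
    enters. One constant serves the whole class of kernels and every [rho]. *)
Lemma cut_integral_le : exists2 C : R, 0 < C &
  forall k rho, kernel_bounds k -> 0 < rho ->
  rV_integrable (cut k rho) /\ rV_int (cut k rho) <= C * rho `^ (- (2 * s)).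
Proof.
pose q : R := 2 `^ (- (2 * s)).
have q01 : 0 <= q < 1.
  rewrite powR_ge0/= /q powRN -powR_V// powR_lt1 ?mulr_gt0//.
  by apply/andP; split; lra.
exists (Lam * 4 ^+ n / (1 - q)).
  by rewrite divr_gt0 ?mulr_gt0 ?exprn_gt0// subr_gt0; case/andP: q01.
move=> k rho kb rho0.
have := @dyadic_integral_le R n (cut k rho) (fun j => rho * 2 ^+ j.+1)
  (fun j => Lam * (rho * 2 ^+ j) `^ (- n%:R - 2 * s))
  (Lam * 4 ^+ n * rho `^ (- (2 * s))) q (cut_measurable kb rho0).
have rj j : 0 < rho * 2 ^+ j by rewrite mulr_gt0// exprn_gt0.
rewrite [in X in _ -> X](mulrAC (Lam * _)); apply => //.
- by move=> z; exact: cut_ge0.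
- by move=> j; exact/ltW.
- by move=> j; rewrite mulr_ge0 ?powR_ge0// ltW.
- move=> z; rewrite {1}/cut; case: ltP => [|zr _]; first by rewrite eqxx.
  have /dyadic_bracket[j /andP[j1 j2]] : 1 <= enorm z / rho.
    by rewrite ler_pdivlMr// mul1r.
  exists j; first by move: j2; rewrite ltr_pdivrMr// mulrC => /ltW.
  apply: le_trans (cut_le kb rho0 zr) _; rewrite ler_pM2l//.
  by apply: le0_ler_powR => //; move: j1; rewrite ler_pdivlMr// mulrC.
(* 4 = 2 * 2: the shell lies in the ball of radius rho 2^(j+1), and that ball in a cube whose side
   is twice this radius. *)
- move=> j; have -> : 2 * (rho * 2 ^+ j.+1) = 4 * (rho * 2 ^+ j).
    by rewrite exprS; ring.
  rewrite exprMn [leLHS](_ : _ = Lam * 4 ^+ n * ((rho * 2 ^+ j) ^+ n *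
    (rho * 2 ^+ j) `^ (- n%:R - 2 * s))); last by ring.
  rewrite expr_powRN// powRM ?exprn_ge0 ?(ltW rho0)// powR_exprn//.
  by rewrite !mulrA.
Qed.

(** Here the shells shrink towards the origin, and |z|^2 beats the singularity with ratio
    2^(-(2-2s)) because s < 1. The bound is free of [rho], which lets the near part survive the
    limit rho -> 0. *)
Lemma cut_sqr_integral_le : exists2 C : R, 0 < C &
  forall k rho b, kernel_bounds k -> 0 < rho -> 0 < b ->
  rV_integrable (fun z => if enorm z <= b then enorm z ^+ 2 * cut k rho z else 0) /\
  rV_int (fun z => if enorm z <= b then enorm z ^+ 2 * cut k rho z else 0)
    <= C * b `^ (2 - 2 * s).
Proof.
pose q : R := 2^-1 `^ (2 - 2 * s).
have q01 : 0 <= q < 1.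
  rewrite powR_ge0/= /q powR_lt1//; last by have := s1; lra.
  by apply/andP; split; lra.
pose A : R := 2^-1 `^ (- n%:R - 2 * s).
exists (Lam * A * 2 ^+ n / (1 - q)).
  by rewrite divr_gt0 ?mulr_gt0 ?exprn_gt0 ?powR_gt0// subr_gt0; case/andP: q01.
move=> k rho b kb rho0 b0; set f := (fun z => _).
have mf : rV_measurable f.
  apply: rV_measurable_restrict.
  apply: measurable_funM; last exact: cut_measurable.
  apply: measurable_funX; exact: (measurable_funT_rV (@continuous_enorm R n)).
pose a j : R := b * 2^-1 ^+ j.
have aj j : 0 < a j by rewrite mulr_gt0// exprn_gt0// invr_gt0.
have := @dyadic_integral_le R n f a
  (fun j => a j ^+ 2 * (Lam * (a j * 2^-1) `^ (- n%:R - 2 * s)))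
  (Lam * A * 2 ^+ n * b `^ (2 - 2 * s)) q mf.
rewrite [in X in _ -> X](mulrAC (Lam * _ * _)); apply => //.
- move=> z; rewrite /f; case: ifP => // _; rewrite mulr_ge0 ?sqr_ge0//.
  exact: cut_ge0.
- by move=> j; exact/ltW.
- by move=> j; rewrite !mulr_ge0 ?powR_ge0 ?sqr_ge0// ltW.
- move=> z; rewrite /f; case: leP => [zb|]; last by rewrite eqxx.
  rewrite mulf_eq0 negb_or => /andP[_]; rewrite {1}/cut.
  case: ltP => [|zr _]; first by rewrite eqxx.
  have z0 : 0 < enorm z by exact: lt_le_trans rho0 _.
  have /dyadic_bracket[j /andP[j1 j2]] : 1 <= b / enorm z.
    by rewrite ler_pdivlMr// mul1r.
  have h1 : enorm z <= a j.
    by rewrite /a exprVn ler_pdivlMr ?exprn_gt0// mulrC -ler_pdivlMr.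
  have h2 : a j * 2^-1 <= enorm z.
    rewrite /a -mulrA -exprSr exprVn ler_pdivrMr ?exprn_gt0//.
    by rewrite mulrC -ler_pdivrMr// ltW.
  exists j => //; apply: ler_pM; rewrite ?sqr_ge0//; first exact: cut_ge0.
    by rewrite lerXn2r ?nnegrE ?enorm_ge0// ltW.
  apply: le_trans (cut_le kb rho0 zr) _; rewrite ler_pM2l//.
  by apply: le0_ler_powR => //; rewrite mulr_gt0// invr_gt0.
- move=> j; rewrite powRM ?invr_ge0 ?(ltW (aj _))// -/A (exprMn n 2 (a j)).
  rewrite [leLHS](_ : _ = Lam * A * 2 ^+ n * (a j ^+ 2 * (a j ^+ n *
    a j `^ (- n%:R - 2 * s)))); last by ring.
  rewrite expr_powRN// expr2_powRN// /a powRM ?exprn_ge0 ?invr_ge0 ?(ltW b0)//.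
  by rewrite powR_exprn ?invr_ge0// !mulrA.
Qed.

(** Source of the good term. It suffices to integrate over the cube of points with all coordinates
    in [r, 2r]: its measure r^n is explicit, and its points have norm between r and sqrt(n) 2r. The
    lower bound on the norm reads off one coordinate, hence n > 0. *)
Lemma kernel_integral_ge : (0 < n)%N -> exists2 c : R, 0 < c &
  forall k g r, kernel_bounds k -> 0 < r ->
  rV_integrable g -> (forall z, 0 <= g z) ->
  (forall z, r <= enorm z <= Num.sqrt n%:R * (2 * r) -> k z <= g z) ->
  c * r `^ (- (2 * s)) <= rV_int g.
Proof.
move=> n0; pose S : R := Num.sqrt n%:R * 2.
have S0 : 0 < S by rewrite mulr_gt0// sqrtr_gt0 ltr0n.
exists (lam * S `^ (- n%:R - 2 * s)); first by rewrite mulr_gt0// powR_gt0.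
move=> k g r kb r0 ig g0 kg.
pose B : set (n.-tuple R) := [set z | forall i, tnth z i \in `[r, (2 * r)]].
have mB : measurable B by exact: measurable_cube.
pose m := lam * (S * r) `^ (- n%:R - 2 * s).
have m0 : 0 <= m by rewrite mulr_ge0 ?powR_ge0// ltW.
rewrite /rV_int /Rintegral -lee_fin fineK; last exact: integrable_fin_num.
apply: (@le_trans _ _ (\int[lebesgue_tuple R n]_z (m * \1_B z)%:E)%E); last first.
  apply: ge0_le_integral => //.
  - by move=> z _; rewrite lee_fin mulr_ge0.
  - by apply/measurable_EFinP; apply: measurable_funM => //; exact: (measurable_indic mB).
  - by apply/measurable_EFinP; exact: rV_integrable_measurable ig.
  move=> z _; rewrite lee_fin indicE; have [zB|zB] := boolP (z \in B); last by rewrite mulr0.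
  rewrite mulr1; move: zB; rewrite inE => zB.
  have zr : r <= enorm (rV_of_tuple z).
    have := zB (Ordinal n0); rewrite in_itv/= => /andP[h _].
    apply: le_trans h _; apply: le_trans (ler_norm _) _.
    by have := ler_coord_enorm (rV_of_tuple z) (Ordinal n0); rewrite mxE.
  have zR : enorm (rV_of_tuple z) <= Num.sqrt n%:R * (2 * r).
    apply: ler_enorm_coord; first by rewrite mulr_ge0// ltW.
    move=> i; rewrite mxE; have := zB i; rewrite in_itv/= => /andP[h1 h2].
    by rewrite ger0_norm// (le_trans (ltW r0)).
  apply: le_trans (kg _ _); last by rewrite zr zR.
  have zn0 : rV_of_tuple z != 0 by rewrite -enorm_gt0 (lt_le_trans r0).
  have [kl _ _ _] := kb.2 _ zn0.
  apply: le_trans kl; rewrite ler_pM2l//; apply: le0_ler_powR => //.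
    exact: lt_le_trans zr.
  by rewrite -mulrA.
under eq_integral do rewrite EFinM.
have mi : measurable_fun setT (EFin \o \1_B : n.-tuple R -> \bar R).
  by apply/measurable_EFinP; exact: (measurable_indic mB).
rewrite ge0_integralZl ?lee_fin//.
rewrite integral_indic// setIT.
rewrite [X in (_ * X)%E](_ : _ = ((2 * r - r) ^+ n)%:E); last first.
  by apply: lebesgue_tuple_cube; lra.
rewrite -EFinM lee_fin (_ : 2 * r - r = r); last by ring.
rewrite /m powRM ?(ltW S0) ?(ltW r0)// -(expr_powRN n s r0).
by rewrite le_eqVlt; apply/orP; left; apply/eqP; ring.
Qed.

End kernel.

(** * Differentiation along lines *)

Section lines.
Context {R : realType}.

Lemma derive_grad n (f : 'rV[R]_n -> R) (y v : 'rV[R]_n) : differentiable f y ->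
  'D_v f y = \sum_(i < n) v 0 i * grad f y 0 i.
Proof.
move=> df; rewrite deriveE// {1}(row_sum_delta v) linear_sum/=.
by apply: eq_bigr => i _; rewrite linearZ/= mxE deriveE.
Qed.

Lemma ler_derive_grad n (f : 'rV[R]_n -> R) (y v : 'rV[R]_n) :
  differentiable f y -> `|'D_v f y| <= enorm v * enorm (grad f y).
Proof. by move=> df; rewrite derive_grad// ler_dot_enorm. Qed.

Lemma is_derive_line (V : normedModType R) (f : V -> R) (x v : V) (t : R) :
  derivable f (x + t *: v) v ->
  is_derive t 1 (fun r => f (x + r *: v)) ('D_v f (x + t *: v)).
Proof.
have E : (fun h : R => h^-1 *: ((f \o shift (x + t *: v)) (h *: v) - f (x + t *: v))) =
   (fun h : R => h^-1 *: (((fun r => f (x + r *: v)) \o shift t) (h *: 1) - f (x + t *: v))).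
  apply/funext => h /=; congr (_ *: (f _ - _)).
  by rewrite addrCA scalerDl [h *: 1]mulr1.
by move=> df; split; rewrite /derivable /derive -E.
Qed.

Lemma MVT_line (V : normedModType R) (f : V -> R) (x v : V) (h : R) : 0 <= h ->
  (forall t, 0 <= t <= h -> derivable f (x + t *: v) v) ->
  exists2 t : R, 0 <= t <= h & f (x + h *: v) - f x = 'D_v f (x + t *: v) * h.
Proof.
move=> h0 df.
have [||t] := @MVT_segment R (fun r => f (x + r *: v))
  (fun r => 'D_v f (x + r *: v)) 0 h h0.
- move=> t; rewrite in_itv/= => /andP[/ltW t0 /ltW t1].
  by apply: is_derive_line; apply: df; rewrite t0.
- apply: derivable_within_continuous => t; rewrite in_itv/= => t01.
  by have [] := is_derive_line (df t t01).
- rewrite in_itv/= => t01; rewrite subr0 scale0r addr0 => tE.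
  by exists t.
Qed.

End lines.

Section kernel_lipschitz.
Context {R : realType} (n : nat) (s lam Lam : R).
Hypotheses (s01 : 0 < s < 1) (lam0 : 0 < lam) (lamL : lam <= Lam).

(** Since |z + v| >= |z|/2, the two-sided bounds make the values of k comparable, with H = Lam/lam *
    2^(n+2s). The gradient condition, which is relative to k at an intermediate point, then becomes
    a Lipschitz bound relative to [k z]. *)
Lemma kernel_harnack : exists2 H : R, 0 < H &
  forall (k : 'rV[R]_n -> R) z v, kernel_bounds s lam Lam k -> 0 < enorm z ->
  enorm v <= enorm z / 2 ->
  0 < k (z + v) <= H * k z /\
  `|k (z + v) - k z| <= 2 * Lam * H * (enorm v / enorm z) * k z.
Proof.
have Lam0 : 0 < Lam by exact: lt_le_trans lamL.
pose A : R := 2^-1 `^ (- n%:R - 2 * s).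
have A0 : 0 < A by rewrite powR_gt0// invr_gt0.
exists (Lam / lam * A); first by rewrite mulr_gt0// divr_gt0.
move=> k z v kb z0.
have half u : enorm u <= enorm z / 2 -> enorm z / 2 <= enorm (z + u).
  move=> uz; have := ler_enorm_distD z (- u); rewrite opprK enormN; lra.
have zu0 u : enorm u <= enorm z / 2 -> z + u != 0.
  by move=> /half zu; rewrite -enorm_gt0 (lt_le_trans _ zu)// divr_gt0.
have har u : enorm u <= enorm z / 2 -> k (z + u) <= Lam / lam * A * k z.
  move=> uz; have [_ ku _ _] := kb.2 _ (zu0 _ uz).
  apply: le_trans ku _.
  have zn0 : z != 0 by rewrite -enorm_gt0.
  have [kz _ _ _] := kb.2 _ zn0.
  apply: (@le_trans _ _ (Lam / lam * A * (lam * enorm z `^ (- n%:R - 2 * s)))).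
    rewrite [leRHS](_ : _ = Lam * (enorm z `^ (- n%:R - 2 * s) * A)); last first.
      by field; rewrite gt_eqF.
    rewrite ler_pM2l// /A -powRM ?enorm_ge0 ?invr_ge0//.
    apply: le0_ler_powR; [|by rewrite divr_gt0|exact: half].
    by have := ler0n R n; move/andP : s01 => []; lra.
  by rewrite ler_pM2l// mulr_gt0// divr_gt0.
move=> vz; split; first by rewrite (kernel_gt0 lam0 kb (zu0 _ vz)) har.
have tv t : 0 <= t <= 1 -> enorm (t *: v) <= enorm z / 2.
  move=> /andP[t0 t1]; rewrite enormZ ger0_norm//; apply: le_trans vz.
  by rewrite ler_piMl// enorm_ge0.
have dk t : 0 <= t <= 1 -> derivable k (z + t *: v) v.
  by move=> t01; apply: diff_derivable; have [] := kb.2 _ (zu0 _ (tv _ t01)).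
have [t t01] := MVT_line ler01 dk; rewrite scale1r mulr1 => ->.
have [_ _ df gf] := kb.2 _ (zu0 _ (tv _ t01)).
apply: le_trans (ler_derive_grad v df) _.
have zt := half _ (tv _ t01).
apply: le_trans (_ : _ <= enorm v * (Lam * (enorm z / 2)^-1 * (Lam / lam * A * k z))) _.
  rewrite ler_wpM2l ?enorm_ge0//; apply: le_trans gf _.
  apply: ler_pM.
  - by rewrite mulr_ge0 ?invr_ge0 ?enorm_ge0// ltW.
  - exact/ltW/(kernel_gt0 lam0 kb)/zu0/tv.
  - rewrite ler_pM2l// lef_pV2// posrE ?divr_gt0//.
    by apply: lt_le_trans zt; rewrite divr_gt0.
  - exact/har/tv.
rewrite le_eqVlt; apply/orP; left; apply/eqP.
by field; rewrite !gt_eqF.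
Qed.

End kernel_lipschitz.

Section rV_convergence.
Context {R : realType} {n : nat}.

Lemma rV_int_dominated_cvg (f_ : nat -> 'rV[R]_n -> R) (f g : 'rV[R]_n -> R) :
  (forall m, rV_measurable (f_ m)) -> rV_measurable f -> rV_integrable g ->
  (forall x, f_ m x @[m --> \oo] --> f x) ->
  (forall m x, `|f_ m x| <= g x) ->
  rV_int (f_ m) @[m --> \oo] --> rV_int f.
Proof.
move=> mf_ mf ig cf fg.
have [||||if_ _ cvf] := @dominated_convergence _ _ _ (lebesgue_tuple R n) setT
  measurableT (fun m => EFin \o (f_ m \o @rV_of_tuple R n))
  (EFin \o (f \o @rV_of_tuple R n)) (EFin \o (g \o @rV_of_tuple R n)) _ _ _ ig.
- by move=> m; apply/measurable_EFinP; exact: mf_.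
- by apply/measurable_EFinP; exact: mf.
- by apply: aeW => z _; apply: cvg_EFin => //; [exact: nearW|exact: cf].
- by apply: aeW => z m _; rewrite lee_fin fg.
apply: fine_cvg; rewrite fineK//; exact: integrable_fin_num.
Qed.

Lemma continuous_bounded_ball (g : 'rV[R]_n -> R) (x : 'rV[R]_n) (c : R) :
  continuous g -> exists2 M, 0 <= M & forall y, enorm (x - y) <= c -> `|g y| <= M.
Proof.
move=> cg.
have [c0|c0] := ltP c 0.
  by exists 0 => // y /le_lt_trans /(_ c0); rewrite ltNge enorm_ge0.
have [||y _ ymax] := @EVT_max_rV R n (fun y => `|g y|) _ _ (@compact_enorm_le R n x c).
- by exists x; rewrite /= subrr enorm0.
- apply: continuous_subspaceT => y; apply: continuous_comp; first exact: cg.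
  exact: norm_continuous.
by exists `|g y| => // z zc; apply: ymax; rewrite inE.
Qed.

End rV_convergence.

(** * Cutoff and integration by parts *)

Section cutoff.
Context {R : realType}.

Lemma ler_dist_min (a b c d t : R) : `|a - c| <= t -> `|b - d| <= t ->
  `|Num.min a b - Num.min c d| <= t.
Proof.
rewrite !ler_norml => /andP[h1 h2] /andP[h3 h4].
by case: (leP a b) => ab; case: (leP c d) => cd; apply/andP; split; lra.
Qed.

Lemma ler_dist_max (a b c d t : R) : `|a - c| <= t -> `|b - d| <= t ->
  `|Num.max a b - Num.max c d| <= t.
Proof.
rewrite !ler_norml => /andP[h1 h2] /andP[h3 h4].
by case: (leP a b) => ab; case: (leP c d) => cd; apply/andP; split; lra.
Qed.

(** A trapezoidal profile in |z|: 0 up to r, 1 from 2r to b, 0 again from 2b on. When 2r <= b the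
    outer slope 1/b is no steeper than the inner slope 1/r. *)
Definition cutoff n (r b : R) (z : 'rV[R]_n) : R :=
  Num.min (Num.min 1 (Num.max 0 (enorm z / r - 1))) (Num.max 0 (2 - enorm z / b)).

Context (n : nat) (r b : R).
Hypotheses (r0 : 0 < r) (rb : 2 * r <= b).
Implicit Types z v : 'rV[R]_n.

Let b0 : 0 < b. Proof. by have := r0; have := rb; lra. Qed.

Lemma cutoff_ge0 z : 0 <= cutoff r b z.
Proof. by rewrite /cutoff !le_min ler01 !le_max lexx. Qed.

Lemma cutoff_le1 z : cutoff r b z <= 1.
Proof. by rewrite /cutoff !ge_min lexx. Qed.

Lemma cutoff_near z : enorm z <= r -> cutoff r b z = 0.
Proof.
move=> zr; apply/eqP; rewrite eq_le cutoff_ge0 andbT.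
rewrite /cutoff !ge_min ge_max lexx subr_le0 ler_pdivrMr// mul1r zr.
by rewrite orbT.
Qed.

Lemma cutoff_far z : 2 * b <= enorm z -> cutoff r b z = 0.
Proof.
move=> zr; apply/eqP; rewrite eq_le cutoff_ge0 andbT.
by rewrite /cutoff ge_min ge_max lexx subr_le0 ler_pdivlMr// zr orbT.
Qed.

Lemma cutoff_mid z : 2 * r <= enorm z <= b -> cutoff r b z = 1.
Proof.
move=> /andP[z1 z2]; apply/eqP; rewrite eq_le cutoff_le1/=.
have h1 : 2 <= enorm z / r by rewrite ler_pdivlMr.
have h2 : enorm z / b <= 1 by rewrite ler_pdivrMr// mul1r.
rewrite /cutoff !le_min lexx !le_max/=.
by apply/andP; split; apply/orP; right; lra.
Qed.

Lemma cutoff_lip z v : `|cutoff r b (z + v) - cutoff r b z| <= enorm v / r.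
Proof.
have h : `|enorm (z + v) - enorm z| <= enorm v.
  by apply: le_trans (ler_dist_enorm _ _) _; rewrite addrC addKr.
have t0 : 0 <= enorm v / r by rewrite divr_ge0 ?enorm_ge0// ltW.
rewrite /cutoff; apply: ler_dist_min.
  apply: ler_dist_min; first by rewrite subrr normr0.
  apply: ler_dist_max; first by rewrite subrr normr0.
  rewrite [X in `|X|](_ : _ = (enorm (z + v) - enorm z) / r); last by ring.
  by rewrite normrM (gtr0_norm (_ : 0 < r^-1)) ?invr_gt0// ler_pM2r ?invr_gt0.
apply: ler_dist_max; first by rewrite subrr normr0.
rewrite [X in `|X|](_ : _ = - ((enorm (z + v) - enorm z) / b)); last by ring.
rewrite normrN normrM (gtr0_norm (_ : 0 < b^-1)) ?invr_gt0//.
apply: ler_pM; rewrite ?invr_ge0 ?(ltW b0)// lef_pV2 ?posrE//.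
by have := rb; have := r0; lra.
Qed.

Lemma cutoffN z : cutoff r b (- z) = cutoff r b z.
Proof. by rewrite /cutoff enormN. Qed.

Lemma continuous_cutoff : continuous (@cutoff n r b).
Proof.
move=> z; apply/(@cvgrPdist_lt _ _ _ (nbhs z) (nbhs_filter z)) => t t0.
have := near_enorm z (mulr_gt0 t0 r0).
apply: filterS => y zy; have := cutoff_lip y (z - y); rewrite [y + _]addrC subrK => h.
by apply: le_lt_trans h _; rewrite ltr_pdivrMr.
Qed.

End cutoff.

Section integration_by_parts.
Context {R : realType} (n : nat) (s lam Lam : R).
Hypotheses (s01 : 0 < s < 1) (lam0 : 0 < lam) (lamL : lam <= Lam).

(** No growth of [g] is known; the bounded support of [f] lets its maximum on a ball replace it. *)
Lemma rV_integrable_local (k : 'rV[R]_n -> R) rho c (f g : 'rV[R]_n -> R) :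
  kernel_bounds s lam Lam k -> 0 < rho -> continuous g -> rV_measurable f ->
  (forall z, `|f z| <= cut k rho z) -> (forall z, c < enorm z -> f z = 0) ->
  rV_integrable (fun z => g z * f z).
Proof.
move=> kb rho0 cg mf fk f0.
have [M M0 gM] := continuous_bounded_ball 0 c cg.
have [C _ /(_ k rho kb rho0)[ik _]] := cut_integral_le n s01 lam0 lamL.
apply: rV_integrable_le (rV_integrableZ M ik).
  by apply: measurable_funM => //; exact: measurable_funT_rV.
move=> z; have [zc|zc] := leP (enorm z) c.
  by rewrite normrM ler_pM// gM// sub0r enormN.
by rewrite f0// mulr0 normr0 mulr_ge0// (cut_ge0 lam0 _ kb).
Qed.

(** [cut k (r / 2)] jumps on the sphere of radius r/2, but the cutoff vanishes up to r, so the jump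
    is invisible in the product. The slope 1/r of the cutoff and the relative slope of order 1/|z|
    of the kernel, with |z| >= r/2, both cost a factor 1/r. The radius 3b leaves room for shifting a
    support of radius 2b by [v]. *)
Lemma cutoff_kernel_lip : exists2 C : R, 0 < C &
  forall k r b (z v : 'rV[R]_n), kernel_bounds s lam Lam k -> 0 < r -> 2 * r <= b ->
  enorm v <= r / 4 ->
  `|cutoff r b (z + v) * cut k (r / 2) (z + v) - cutoff r b z * cut k (r / 2) z|
  <= C / r * enorm v * (if enorm z <= 3 * b then cut k (r / 2) z else 0).
Proof.
have Lam0 : 0 < Lam by exact: lt_le_trans lamL.
have [H H0 har] := kernel_harnack n s01 lam0 lamL.
exists (H * (1 + 4 * Lam)); first by rewrite !mulr_gt0// addr_gt0// mulr_gt0.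
move=> k r b z v kb r0 rb vr.
have hr : 0 < r / 2 by rewrite divr_gt0.
have b0 : 0 < b by lra.
have phiE y : cutoff r b y * cut k (r / 2) y = cutoff r b y * k y.
  rewrite /cut; case: ltP => // yr; rewrite cutoff_near ?mul0r//; lra.
have nonneg : 0 <= H * (1 + 4 * Lam) / r * enorm v.
  rewrite mulr_ge0 ?enorm_ge0// divr_ge0 ?(ltW r0)// mulr_ge0 ?(ltW H0)//.
  by rewrite addr_ge0// mulr_ge0// ltW.
have zv1 := ler_enormD z v.
have zv2 : enorm z - enorm v <= enorm (z + v).
  by have := ler_enorm_distD z (- v); rewrite opprK enormN; lra.
(* Here z and z + v both lie within r, where the cutoff is 0. *)
have [zr|zr] := ltP (enorm z) (r / 2).
  rewrite !cutoff_near ?mul0r ?subr0 ?normr0; try lra.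
  by rewrite mulr_ge0//; case: ifP => // _; exact: (cut_ge0 lam0 _ kb).
have [zb|zb] := leP (enorm z) (3 * b); last first.
  by rewrite mulr0 !(cutoff_far (b := b)) ?mul0r ?subr0 ?normr0//; lra.
rewrite !phiE {1}/cut ltNge zr/=.
have z0 : 0 < enorm z by lra.
have vz : enorm v <= enorm z / 2 by lra.
have [/andP[_ h1] h2] := har _ _ _ kb z0 vz.
have kz : 0 < k z by apply: (kernel_gt0 lam0 kb); rewrite -enorm_gt0.
rewrite (_ : _ - _ = (cutoff r b (z + v) - cutoff r b z) * k (z + v) +
  cutoff r b z * (k (z + v) - k z)); last by ring.
apply: le_trans (ler_normD _ _) _; rewrite !normrM.
apply: le_trans (_ : _ <= enorm v / r * (H * k z) +
  1 * (2 * Lam * H * (enorm v / (r / 2)) * k z)) _; last first.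
  by rewrite le_eqVlt; apply/orP; left; apply/eqP; field; rewrite gt_eqF.
apply: lerD.
  apply: ler_pM; rewrite ?cutoff_lip//.
  have zv0 : z + v != 0 by rewrite -enorm_gt0; lra.
  by rewrite gtr0_norm// (kernel_gt0 lam0 kb).
apply: ler_pM => //; first by rewrite ger0_norm ?cutoff_ge0// cutoff_le1.
apply: le_trans h2 _; rewrite ler_pM2r// ler_pM2l ?mulr_gt0//.
by rewrite ler_wpM2l ?enorm_ge0// lef_pV2 ?posrE.
Qed.

(* The derivative falling on u is replaced by a difference quotient, which translation
   invariance moves onto the weight; the weight is only known to be Lipschitz. *)
Lemma cutoff_integral_by_parts : exists2 C : R, 0 < C &
  forall k (u : 'rV[R]_n -> R) (e x : 'rV[R]_n) r b, kernel_bounds s lam Lam k ->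
  enorm e = 1 -> 0 < r -> 2 * r <= b ->
  continuous u -> (forall y, derivable u y e) -> continuous ('D_e u) ->
  `|rV_int (fun z : 'rV[R]_n => cutoff r b z * 'D_e u (x - z) * cut k (r / 2) z)| <=
  C / r * rV_int (fun z : 'rV[R]_n => `|u (x - z) - u x| *
     (if enorm z <= 3 * b then cut k (r / 2) z else 0)).
Proof.
have [C C0 lipC] := cutoff_kernel_lip.
exists C => // k u e x r b kb e1 r0 rb cu du cw.
have hr : 0 < r / 2 by rewrite divr_gt0.
have b0 : 0 < b by lra.
pose U (z : 'rV[R]_n) := u (x - z) - u x.
pose phi z := cutoff r b z * cut k (r / 2) z.
have cU (c : 'rV[R]_n) : continuous (fun z : 'rV[R]_n => u (c - z) - u x).
  move=> z; apply: (@continuousB _ _ _ (fun z : 'rV[R]_n => u (c - z)) (cst (u x))).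
    by apply: continuous_comp; [exact: continuous_rVB|exact: cu].
  exact: cst_continuous.
have cwx : continuous (fun z : 'rV[R]_n => 'D_e u (x - z)).
  move=> z; apply: (@continuous_comp _ _ _ (fun z : 'rV[R]_n => x - z) ('D_e u)).
    exact: continuous_rVB.
  exact: cw.
have mphi : rV_measurable phi.
  apply: measurable_funM; last exact: cut_measurable kb hr.
  by exact: (measurable_funT_rV (continuous_cutoff r0 rb)).
have phi0 z : 0 <= phi z by rewrite mulr_ge0 ?cutoff_ge0// (cut_ge0 lam0 _ kb).
have phik z : `|phi z| <= cut k (r / 2) z.
  by rewrite ger0_norm// ler_piMl ?cutoff_le1// (cut_ge0 lam0 _ kb).
have phifar z : 2 * b < enorm z -> phi z = 0.
  by move=> /ltW zb; rewrite /phi cutoff_far ?mul0r.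
have iphi (g : 'rV[R]_n -> R) : continuous g -> rV_integrable (fun z : 'rV[R]_n => g z * phi z).
  by move=> cg; exact: (rV_integrable_local kb hr cg mphi phik phifar).
pose ann (z : 'rV[R]_n) := if enorm z <= 3 * b then cut k (r / 2) z else 0.
have mann : rV_measurable ann.
  by apply: rV_measurable_restrict; exact: cut_measurable kb hr.
have iann : rV_integrable (fun z : 'rV[R]_n => `|U z| * ann z).
  apply: (@rV_integrable_local k (r / 2) (3 * b)) => //.
  - move=> z; apply: continuous_comp; first exact: (cU x).
    exact: norm_continuous.
  - move=> z; rewrite /ann; case: ifP => _.
      by rewrite ger0_norm// (cut_ge0 lam0 _ kb).
    by rewrite normr0 (cut_ge0 lam0 _ kb).
  - by move=> z zb; rewrite /ann leNgt zb.
(* Step sizes tending to 0 and never above r/4, the range of [cutoff_kernel_lip]. *)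
pose h (m : nat) : R := r / 4 * m.+1%:R^-1.
have h0 m : 0 < h m by rewrite !mulr_gt0 ?invr_gt0.
have hle m : h m <= r / 4.
  by rewrite ler_piMr ?divr_ge0 ?(ltW r0)// invf_le1// ler1n.
pose f m (z : 'rV[R]_n) := (h m)^-1 * ((u (x - z + h m *: e) - u (x - z)) * phi z).
have fle m : `|rV_int (f m)| <= C / r * rV_int (fun z : 'rV[R]_n => `|U z| * ann z).
  pose v := h m *: e.
  have i1 : rV_integrable (fun z : 'rV[R]_n => (u (x + v - z) - u x) * phi z).
    by apply: iphi; exact: (cU (x + v)).
  have i2 : rV_integrable (fun z : 'rV[R]_n => (u (x - z) - u x) * phi z).
    by apply: iphi; exact: (cU x).
  have i1' := rV_integrable_affine v (normr1 _) i1.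
  have e1' := rV_int_affine v (normr1 _) i1.
  (* Translating only the first term by [v] moves the increment from u to [phi]. The constant [u x],
     inserted in both terms beforehand, cancels in [f m]; after the translation it leaves u(x - z) -
     u(x) in front of the increment of [phi]. *)
  have -> : rV_int (f m) = (h m)^-1 * rV_int (fun z : 'rV[R]_n =>
      (u (x + v - (1 *: z + v)) - u x) * phi (1 *: z + v) - (u (x - z) - u x) * phi z).
    rewrite rV_intB// e1' -rV_intB// -rV_intZ; last exact: rV_integrableB.
    congr rV_int; apply/funext => z; rewrite /f -/v.
    by congr (_ * _); rewrite -mulrBl [x + v - z]addrAC; congr (_ * _); ring.
  rewrite normrM (gtr0_norm (_ : 0 < (h m)^-1)) ?invr_gt0//.
  rewrite ler_pdivrMl// mulrA -rV_intZ//; apply: ler_norm_rV_int.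
  - exact: rV_integrableB.
  - exact: rV_integrableZ.
  move=> z; rewrite scale1r (_ : x + v - (z + v) = x - z); last first.
    by rewrite opprD addrACA subrr addr0.
  rewrite -mulrBr normrM -/(U z) [leRHS]mulrCA ler_wpM2l//.
  have vE : enorm v = h m by rewrite enormZ e1 mulr1 gtr0_norm.
  have := @lipC k r b z v kb r0 rb; rewrite vE => /(_ (hle m)).
  by rewrite -/(phi _) -/(phi _) -/(ann z) [h m * _]mulrC.
have cvf : rV_int (f m) @[m --> \oo] -->
    rV_int (fun z : 'rV[R]_n => cutoff r b z * 'D_e u (x - z) * cut k (r / 2) z).
  (* Where [phi] is nonzero, the difference quotients are values of ['D_e u] at points within 2b +
     r/4 <= 3b of x, by the mean value theorem; hence [M * phi] dominates. *)
  have [M M0 wM] := continuous_bounded_ball x (3 * b) cw.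
  have := @rV_int_dominated_cvg R n f
    (fun z : 'rV[R]_n => cutoff r b z * 'D_e u (x - z) * cut k (r / 2) z) (fun z : 'rV[R]_n => M * phi z).
  apply.
  - move=> m; pose v := h m *: e.
    have -> : f m = fun z : 'rV[R]_n => (h m)^-1 *
        (((u (x + v - z) - u x) - (u (x - z) - u x)) * phi z).
      apply/funext => z; rewrite /f -/v [x + v - z]addrAC; congr (_ * (_ * _)); ring.
    apply: measurable_funM => //; apply: measurable_funM => //.
    by apply: measurable_funB; exact: (measurable_funT_rV (cU _)).
  - apply: measurable_funM; last exact: cut_measurable kb hr.
    apply: measurable_funM; first by exact: (measurable_funT_rV (continuous_cutoff r0 rb)).
    exact: (measurable_funT_rV cwx).
  - by apply: iphi => z; exact: cst_continuous.
  - move=> z; rewrite (_ : _ * _ = 'D_e u (x - z) * phi z); last by rewrite /phi; ring.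
    have -> : f^~ z = (fun m => ((h m)^-1 *: (u (h m *: e + (x - z)) - u (x - z))) * phi z).
      by apply/funext => m; rewrite /f mulrA [h m *: e + _]addrC.
    apply: cvgMl.
    have /cvg_ex[l lE] := du (x - z).
    have -> : 'D_e u (x - z) = l by apply: cvg_lim.
    have h_cvg : h m @[m --> \oo] --> 0^'.
      apply: cvg_trans (_ : _ --> within (fun t => t != 0) (nbhs (0 : R))); last by [].
      move=> A /= A0; rewrite /within/= in A0.
      have hc : h m @[m --> \oo] --> (0 : R).
        rewrite -(mulr0 (r / 4)); apply: cvgM; [exact: cvg_cst|exact: cvg_harmonic].
      have B : \forall m \near \oo, h m != 0 -> A (h m) by exact: (hc _ A0).
      by apply: filterS B => m; apply; exact: lt0r_neq0 (h0 m).
    exact: cvg_comp h_cvg lE.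
  - move=> m z; rewrite /f mulrA normrM (ger0_norm (phi0 z)).
    have [zb|zb] := leP (enorm z) (2 * b); last by rewrite phifar// !mulr0.
    rewrite ler_wpM2r//.
    have [t /andP[t0 t1] ->] := @MVT_line R _ u (x - z) e (h m) (ltW (h0 m)) (fun t _ => du _).
    rewrite mulrCA mulVf ?gt_eqF// mulr1; apply: wM.
    rewrite opprD addrA opprB addrCA subrr addr0.
    apply: le_trans (ler_enormD _ _) _; rewrite enormN enormZ e1 mulr1 ger0_norm//.
    by have := hle m; lra.
rewrite ler_norml; apply/andP; split.
  apply: cvgr_to_ge cvf _; apply: nearW => m.
  by have := fle m; rewrite ler_norml => /andP[].
apply: cvgr_to_le cvf _; apply: nearW => m.
by have := fle m; rewrite ler_norml => /andP[].
Qed.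

End integration_by_parts.

(** * The weight eta *)

Section C11c_estimates.
Context {R : realType} (n : nat) (f : 'rV[R]_n -> R) (N : R).
Hypotheses (fC : C11c f) (fN : C11_norm f = N%:E).
Implicit Types x y z : 'rV[R]_n.

Let eball0 : eball R n 0. Proof. by rewrite /eball/= enorm0. Qed.

(** Each of the three suprema is non-negative because the ball contains 0, so each is at most their
    sum. For the third, the pair (0, 0) contributes the quotient 0/0 = 0. *)
Lemma C11_norm_bounds :
  [/\ forall x, eball R n x -> `|f x| <= N,
      forall x, eball R n x -> enorm (grad f x) <= N &
      forall x y, eball R n x -> eball R n y ->
        enorm (grad f x - grad f y) <= N * enorm (x - y)].
Proof.
move: fN; rewrite /C11_norm; set A := ereal_sup _; set B := ereal_sup _.
set C := ereal_sup _ => ABC.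
have A0 : (0 <= A)%E.
  apply: le_trans (_ : (`|f 0|%:E <= _)%E); first by rewrite lee_fin.
  by apply: ereal_sup_ubound; exists 0.
have B0 : (0 <= B)%E.
  apply: le_trans (_ : ((enorm (grad f 0))%:E <= _)%E).
    by rewrite lee_fin enorm_ge0.
  by apply: ereal_sup_ubound; exists 0.
have C0 : (0 <= C)%E.
  apply: le_trans (_ : ((enorm (grad f 0 - grad f 0) / enorm (0 - 0 : 'rV[R]_n))%:E <= _)%E).
    by rewrite lee_fin mulr_ge0 ?invr_ge0 ?enorm_ge0.
  by apply: ereal_sup_ubound; exists (0, 0).
have AN : (A <= N%:E)%E by rewrite -ABC -addeA leeDl// adde_ge0.
have BN : (B <= N%:E)%E by rewrite -ABC addeAC leeDr// adde_ge0.
have CN : (C <= N%:E)%E by rewrite -ABC leeDr// adde_ge0.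
split.
- move=> x xB; rewrite -lee_fin; apply: le_trans AN.
  by apply: ereal_sup_ubound; exists x.
- move=> x xB; rewrite -lee_fin; apply: le_trans BN.
  by apply: ereal_sup_ubound; exists x.
- move=> x y xB yB; have [->|xy] := eqVneq x y.
    by rewrite !subrr !enorm0 mulr0.
  rewrite -ler_pdivrMr; last by rewrite enorm_gt0 subr_eq0.
  rewrite -lee_fin; apply: le_trans CN.
  by apply: ereal_sup_ubound; exists (x, y).
Qed.

Let N0 : 0 <= N.
Proof. by have [h _ _] := C11_norm_bounds; exact: le_trans (h _ eball0). Qed.

Lemma C11c_near0 x : ~ eball R n x -> \near x, 0 = f x.
Proof.
move=> xB; have [_ sB _ _] := fC.
have : nbhs x (~` closure [set y | f y != 0]).
  apply: open_nbhs_nbhs; split; first exact/closed_openC/closed_closure.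
  by move/sB.
apply: filterS => y /= yS; apply/esym/eqP/negPn/negP => fy.
by apply: yS; exact: subset_closure.
Qed.

Lemma C11c_out x : ~ eball R n x -> f x = 0.
Proof. by move=> /C11c_near0 /nbhs_singleton. Qed.

(** Off the ball f vanishes in a whole neighbourhood, the closed support lying inside the ball; this
    carries the gradient bound to all of R^n. *)
Lemma C11c_derivable x v : derivable f x v /\ `|'D_v f x| <= N * enorm v.
Proof.
have [xB|xB] := pselect (eball R n x).
  have df : differentiable f x by have [_ _ + _] := fC; exact.
  split; first exact: diff_derivable.
  apply: le_trans (ler_derive_grad _ df) _; rewrite mulrC ler_wpM2r ?enorm_ge0//.
  by have [_ h _] := C11_norm_bounds; exact: h.
have nf := C11c_near0 xB; split.
  by apply: near_eq_derivable nf _; exact: derivable_cst.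
rewrite -(near_eq_derive v nf) (derive_cst (0 : R) x v) normr0.
by rewrite mulr_ge0 ?enorm_ge0.
Qed.

Lemma C11c_le x : `|f x| <= N.
Proof.
have [xB|/C11c_out ->] := pselect (eball R n x); last by rewrite normr0.
by have [h _ _] := C11_norm_bounds; exact: h.
Qed.

Lemma C11c_lip x z : `|f (x + z) - f x| <= N * enorm z.
Proof.
have [t _] := MVT_line ler01 (fun t _ => (C11c_derivable (x + t *: z) z).1).
by rewrite scale1r mulr1 => ->; have [] := C11c_derivable (x + t *: z) z.
Qed.

Lemma C11c_continuous : continuous f.
Proof.
move=> x; apply/(@cvgrPdist_lt _ _ _ (nbhs x) (nbhs_filter x)) => e e0.
have N1 : 0 < N + 1 by rewrite ltr_wpDl.
apply: filterS (near_enorm x (divr_gt0 e0 N1)) => y xy.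
have := C11c_lip y (x - y); rewrite [y + _]addrC subrK => h.
apply: le_lt_trans h _; move: xy; rewrite ltr_pdivlMr// mulrC; apply: le_lt_trans.
by rewrite ler_wpM2r ?enorm_ge0// lerDl.
Qed.

(** f is N-Lipschitz on R^n and 0 off the ball. This keeps increments that are small compared with
    f(x) in the region where the gradient is Lipschitz. *)
Lemma C11c_ball x z : N * enorm z < f x -> eball R n (x + z).
Proof.
move=> Nz; apply: contrapT => /C11c_out fxz.
have := C11c_lip x z; rewrite fxz sub0r normrN.
by rewrite leNgt (lt_le_trans Nz)// ler_norm.
Qed.

(** The derivative of t -> f(x + tz) + f(x - tz) is z dotted with the difference of two gradients
    taken at distance 2t|z|, hence at most 2N|z|^2. The condition on z keeps both segments in the
    ball. *)
Lemma C11c_second_difference x z : N * enorm z < f x ->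
  `|f (x + z) + f (x - z) - 2 * f x| <= 2 * N * enorm z ^+ 2.
Proof.
move=> Nz.
pose g t := f (x + t *: z) + f (x + t *: (- z)).
have tz (w : 'rV[R]_n) (t : R) : enorm w = enorm z -> 0 <= t <= 1 -> eball R n (x + t *: w).
  move=> wz /andP[t0 t1]; apply: C11c_ball; apply: le_lt_trans Nz.
  by rewrite enormZ ger0_norm// wz ler_wpM2l// ler_piMl// enorm_ge0.
have df (w : 'rV[R]_n) (t : R) : enorm w = enorm z -> 0 <= t <= 1 -> differentiable f (x + t *: w).
  by move=> wz t01; have [_ _ + _] := fC; apply; exact: tz.
have dg (t : R) : 0 <= t <= 1 ->
    is_derive t 1 g ('D_z f (x + t *: z) + 'D_(- z) f (x + t *: (- z))).
  move=> t01; apply: is_deriveD; apply: is_derive_line; apply: diff_derivable.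
    exact: df.
  by apply: df => //; exact: enormN.
have [||t] := @MVT_segment R g
  (fun t => 'D_z f (x + t *: z) + 'D_(- z) f (x + t *: (- z))) 0 1 ler01.
- by move=> t; rewrite in_itv/= => /andP[/ltW t0 /ltW t1]; apply: dg; rewrite t0.
- by apply: derivable_within_continuous => t; rewrite in_itv/= => t01; have [] := dg t t01.
rewrite in_itv/= => t01; rewrite subr0 mulr1 /g !scale1r !scale0r !addr0.
rewrite -mulr2n -[f x *+ 2]mulr_natl => ->.
rewrite (derive_grad z (df z t erefl t01)) (derive_grad (- z) (df (- z) t (enormN z) t01)).
rewrite -big_split/= (eq_bigr (fun i => z 0 i *
  (grad f (x + t *: z) - grad f (x + t *: (- z))) 0 i)); last first.
  by move=> i _; rewrite !mxE; ring.
apply: le_trans (ler_dot_enorm _ _) _.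
have [_ _ h] := C11_norm_bounds.
have /andP[t0 t1] := t01.
have := h _ _ (tz z t erefl t01) (tz (- z) t (enormN z) t01).
rewrite scalerN opprD opprK addrACA subrr add0r -mulr2n -scaler_nat scalerA.
rewrite enormZ ger0_norm ?mulr_ge0// => hz.
rewrite [leRHS](_ : _ = enorm z * (N * (2 * enorm z))); last by ring.
rewrite ler_wpM2l ?enorm_ge0//; apply: le_trans hz _.
by rewrite ler_wpM2l// ler_wpM2r ?enorm_ge0// ler_piMr.
Qed.

End C11c_estimates.

Section eta1_estimates.
Context {R : realType} (g : R -> R) (N : R).
Hypothesis gN : C01_norm g = N%:E.

Lemma C01_norm_bounds :
  (forall t, 0 <= t <= 1 -> `|g t| <= N) /\
  (forall t r, 0 <= t <= 1 -> 0 <= r <= 1 -> `|g t - g r| <= N * `|t - r|).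
Proof.
move: gN; rewrite /C01_norm; set A := ereal_sup _; set B := ereal_sup _ => AB.
have mem01 t : 0 <= t <= 1 -> [set` `[(0 : R), 1]] t by move=> t01; rewrite /= in_itv.
have m0 : [set` `[(0 : R), 1]] 0 by apply: mem01; rewrite lexx ler01.
have A0 : (0 <= A)%E.
  apply: le_trans (_ : (`|g 0|%:E <= _)%E); first by rewrite lee_fin.
  by apply: ereal_sup_ubound; exists 0.
pose F (p : R * R) := (`|g p.1 - g p.2| / `|p.1 - p.2|)%:E.
have BF t r : 0 <= t <= 1 -> 0 <= r <= 1 -> (F (t, r) <= B)%E.
  by move=> t01 r01; apply: ereal_sup_ubound; exists (t, r).
have B0 : (0 <= B)%E.
  apply: le_trans (BF 0 0 _ _); rewrite ?lexx ?ler01//.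
  by rewrite lee_fin mulr_ge0 ?invr_ge0.
have AN : (A <= N%:E)%E by rewrite -AB leeDl.
have BN : (B <= N%:E)%E by rewrite -AB leeDr.
split=> [t t01|t r t01 r01].
  rewrite -lee_fin; apply: le_trans AN.
  by apply: ereal_sup_ubound; exists t; [exact: mem01|].
have [->|tr] := eqVneq t r; first by rewrite !subrr !normr0 mulr0.
rewrite -ler_pdivrMr ?normr_gt0 ?subr_eq0// -lee_fin; apply: le_trans BN.
exact: BF.
Qed.

Lemma C01_derive_le t : 0 < t < 1 -> derivable g t 1 -> `|'D_1 g t| <= N.
Proof.
move=> /andP[t0 t1] dg; have [gb gl] := C01_norm_bounds.
have near01 : \forall h \near (0 : R)^', 0 <= h + t <= 1.
  apply: nbhs_dnbhs.
  have : \forall h \near (0 : R), `|0 - h| < Num.min t (1 - t).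
    by apply/nbhs_normP; exists (Num.min t (1 - t)) => //=; rewrite lt_min t0 subr_gt0.
  apply: filterS => h; rewrite sub0r normrN lt_min => /andP[h1 h2].
  have := ler_norm h; have := ler_norm (- h); rewrite normrN.
  by move=> ? ?; apply/andP; split; lra.
have b : \forall h \near (0 : R)^', `|h^-1 *: ((g \o shift t) (h *: 1) - g t)| <= N.
  near=> h; have hn0 : h != 0 by near: h; exact: nbhs_dnbhs_neq.
  rewrite /= [h *: 1]mulr1 normrZ normfV ler_pdivrMl ?normr_gt0// mulrC.
  have := gl (h + t) t; rewrite addrK; apply; last by rewrite !ltW.
  by near: h.
rewrite ler_norml; apply/andP; split.
  apply: cvgr_to_ge dg _; move: b; apply: filterS => h.
  by rewrite ler_norml => /andP[].
apply: cvgr_to_le dg _; move: b; apply: filterS => h.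
by rewrite ler_norml => /andP[].
Unshelve. all: by end_near. Qed.

End eta1_estimates.

(** With g = eta1^(2s) one has eta1^2 = g^(1/s) near t, and the chain rule puts the factor g^(1/s -
    1) = eta1^(2-2s) in front of g'. A zero of [eta1] needs its own argument: there the derivative
    is 0 because 1/s > 1. *)
Lemma is_derive_sqr_eta1 {R : realType} (s N t : R) (eta1 : R -> R) :
  0 < s < 1 -> 0 < t < 1 -> (forall t, 0 <= t <= 1 -> 0 <= eta1 t) ->
  C01_norm (fun r => eta1 r `^ (2 * s)) = N%:E ->
  derivable (fun r => eta1 r `^ (2 * s)) t 1 ->
  exists2 D, is_derive t 1 (fun r => eta1 r ^+ 2) D &
    `|D| <= N / s * eta1 t `^ (2 - 2 * s).
Proof.
move=> /andP[s0 s1] t01 eta0 gN dg; have /andP[t0 t1] := t01.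
set g := fun r => eta1 r `^ (2 * s) in gN dg.
have near01 : \forall r \near t, 0 <= r <= 1.
  have : \forall h \near t, `|t - h| < Num.min t (1 - t).
    by apply/nbhs_normP; exists (Num.min t (1 - t)) => //=; rewrite lt_min t0 subr_gt0.
  apply: filterS => h; rewrite lt_min => /andP[h1 h2].
  have := ler_norm (t - h); have := ler_norm (- (t - h)); rewrite normrN.
  by move=> ? ?; apply/andP; split; lra.
have sqE r : 0 <= r <= 1 -> g r `^ s^-1 = eta1 r ^+ 2.
  move=> /eta0 e0; rewrite /g -powRrM mulfK ?gt_eqF//.
  by rewrite powR_mulrn.
have nE : \forall r \near t, g r `^ s^-1 = eta1 r ^+ 2.
  by apply: filterS near01 => r; exact: sqE.
have g0 r : 0 <= g r by exact: powR_ge0.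
have t01' : 0 <= t <= 1 by rewrite !ltW.
have Dg := C01_derive_le gN t01 dg.
have Ns0 : 0 <= N / s by rewrite divr_ge0 ?(ltW s0)// (le_trans _ Dg).
have := eta0 _ t01'; rewrite le_eqVlt => /predU1P[et0|et0].
  exists 0; last by rewrite normr0 mulr_ge0// powR_ge0.
  apply: near_eq_is_derive nE _.
  have gt0 : g t = 0 by rewrite /g -et0 powR0// mulf_neq0 ?gt_eqF.
  have cg : {for t, continuous g} by exact/differentiable_continuous/derivable1_diffP.
  pose m r := g r `^ (s^-1 - 1).
  have s1' : 0 < s^-1 - 1 by rewrite subr_gt0 invf_gt1.
  have cm : m h @[h --> t] --> (0 : R).
    apply/cvgrPdist_lt => e e0.
    pose d := e `^ (s^-1 - 1)^-1.
    have d0 : 0 < d by rewrite powR_gt0.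
    have : \forall h \near t, `|g t - g h| < d.
      by move/cvgrPdist_lt : cg => /(_ _ d0).
    apply: filterS => h; rewrite gt0 sub0r normrN ger0_norm// => gd.
    rewrite sub0r normrN ger0_norm ?powR_ge0//.
    apply: lt_le_trans (_ : d `^ (s^-1 - 1) <= e).
      by rewrite gt0_ltr_powR ?nnegrE// ltW.
    by rewrite /d -powRrM mulVf ?gt_eqF// powRr1// ltW.
  (* The difference quotient of g^(1/s) thereby becomes that of g, which converges, times [m], which
     tends to 0. *)
  have gm r : g r `^ s^-1 = g r * m r.
    rewrite /m; have [gr0|gr] := eqVneq (g r) 0.
      by rewrite gr0 mul0r powR0// invr_neq0// gt_eqF.
    rewrite -{2}[g r]powRr1// -powRD; last by rewrite gr implybT.
    by congr (_ `^ _); ring.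
  have lim0 : h^-1 *: (((fun r => g r `^ s^-1) \o shift t) (h *: 1) - g t `^ s^-1)
      @[h --> 0^'] --> (0 : R).
    rewrite gm gt0 mul0r.
    have -> : (fun h : R => h^-1 *: (((fun r => g r `^ s^-1) \o shift t) (h *: 1) - 0)) =
        (fun h : R => (h^-1 *: ((g \o shift t) (h *: 1) - g t)) * (m \o shift t) (h *: 1)).
      by apply/funext => h /=; rewrite gm gt0 !subr0 scalerAl.
    have /cvg_ex[l lE] := dg.
    have := (@cvgM _ _ _ _ (fun h : R => h^-1 *: ((g \o shift t) (h *: 1) - g t))
      (fun h => (m \o shift t) (h *: 1)) l 0 lE).
    rewrite mulr0; apply.
    apply: (@cvg_comp _ _ _ (fun h : R => h *: 1 + t) m _ (nbhs t)); last exact: cm.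
    have ht : (h + t) @[h --> (0 : R)] --> t.
      by rewrite -{2}[t]add0r; apply: cvgD; [exact: cvg_id|exact: cvg_cst].
    have -> : (fun h : R => h *: 1 + t) = (fun h => h + t).
      by apply/funext => h; rewrite [h *: 1]mulr1.
    by move=> A tA; apply: nbhs_dnbhs; exact: ht.
  by split; [apply/cvg_ex; exists 0|apply: cvg_lim].
have gt0 : 0 < g t by rewrite powR_gt0.
exists (s^-1 * g t `^ (s^-1 - 1) * 'D_1 g t).
  apply: near_eq_is_derive nE _.
  exact: (@is_derive1_comp R (fun y => y `^ s^-1) g t _ _
    (is_derive1_powR s^-1 gt0) (derivableP dg)).
rewrite normrM ger0_norm; last by rewrite mulr_ge0 ?powR_ge0// invr_ge0 ltW.
rewrite /g -powRrM (_ : 2 * s * (s^-1 - 1) = 2 - 2 * s); last by field; rewrite gt_eqF.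
rewrite [leRHS](_ : _ = s^-1 * eta1 t `^ (2 - 2 * s) * N); last by ring.
by rewrite ler_wpM2l// mulr_ge0 ?powR_ge0// invr_ge0 ltW.
Qed.

(** * Regularity in space and in time *)

Section smoothness.
Context {R : realType} (n : nat) (u : R -> 'rV[R]_n -> R) (e : 'rV[R]_n).
Hypothesis su : smooth_pos u.

Let U (p : R * 'rV[R]_n) := u p.1 p.2.

(** Smoothness is stated on space-time and [dspace] on a time slice; the two difference quotients
    coincide. *)
Lemma dspaceE t x : dspace e u t x = 'D_(0, e) U (t, x).
Proof.
rewrite /dspace /derive; congr (lim _).
rewrite (_ : (fun h : R => h^-1 *: ((U \o shift (t, x)) (h *: (0, e)) - U (t, x))) =
  (fun h : R => h^-1 *: ((u t \o shift x) (h *: e) - u t x)))//.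
by apply/funext => h; rewrite /U /= scaler0 add0r.
Qed.

Let pair_continuous (t : R) : continuous (fun y : 'rV[R]_n => (t, y)).
Proof.
move=> y; apply: differentiable_continuous.
by apply: (@differentiable_pair R _ _ _ (cst t) id y); exact: ex_diff.
Qed.

Lemma smooth_pos_space t : 0 < t ->
  [/\ continuous (u t), forall y, derivable (u t) y e & continuous (dspace e u t)].
Proof.
move=> t0; split.
- move=> y; apply: (@continuous_comp _ _ _ (fun y => (t, y)) U); first exact: pair_continuous.
  exact: (su 0).
- move=> y; have [/(_ (t, y) t0) dU _] := su 1.
  have := @diff_derivable _ _ _ U (t, y) (0, e) dU; rewrite /derivable.
  rewrite (_ : (fun h : R => h^-1 *: ((U \o shift (t, y)) (h *: (0, e)) - U (t, y))) =
    (fun h : R => h^-1 *: ((u t \o shift y) (h *: e) - u t y)))//.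
  by apply/funext => h; rewrite /U /= scaler0 add0r.
- have -> : dspace e u t = 'D_(0, e) U \o (fun y => (t, y)).
    by apply/funext => y; rewrite dspaceE.
  move=> y; apply: (@continuous_comp _ _ _ (fun y => (t, y)) ('D_(0, e) U)).
    exact: pair_continuous.
  by have [_ /(_ (0, e) (t, y) t0)] := su 1.
Qed.

Lemma derivable_time (V : R * 'rV[R]_n -> R) t x : differentiable V (t, x) ->
  derivable (fun r => V (r, x)) t 1.
Proof.
move=> dV; have := @diff_derivable _ _ _ V (t, x) (1, 0) dV; rewrite /derivable.
rewrite (_ : (fun h : R => h^-1 *: ((V \o shift (t, x)) (h *: (1, 0)) - V (t, x))) =
  (fun h : R => h^-1 *: (((fun r => V (r, x)) \o shift t) (h *: 1) - V (t, x))))//.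
apply/funext => h /=; congr (_ *: (V _ - _)).
by congr pair; rewrite /= scaler0 add0r.
Qed.

(** The time derivative of [dspace e u] is a mixed second derivative, so the second order of
    [smooth_pos] is called upon. *)
Lemma smooth_pos_time t x : 0 < t ->
  derivable (fun r => u r x) t 1 /\ derivable (fun r => dspace e u r x) t 1.
Proof.
move=> t0; split.
  by apply: (@derivable_time U); have [/(_ (t, x) t0)] := su 1.
have -> : (fun r => dspace e u r x) = (fun r => 'D_(0, e) U (r, x)).
  by apply/funext => r; rewrite dspaceE.
by apply: (@derivable_time ('D_(0, e) U)); have [_ /(_ (0, e))[/(_ (t, x) t0)]] := su 2.
Qed.

End smoothness.

Lemma is_derive_sqr {R : realType} (y : R) : is_derive y 1 (fun y : R => y ^+ 2) (2 * y).
Proof.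
split; first exact: exprn_derivable.
by rewrite exp_derive /= expr1; exact: mulr1.
Qed.

(** Squaring removes the corner: at 0 the difference quotient is max(h, 0), which tends to 0. *)
Lemma is_derive_sqr_pospart {R : realType} (y : R) :
  is_derive y 1 (fun y => pospart y ^+ 2) (2 * pospart y).
Proof.
have [y0|y0|->] := ltgtP y 0.
- have -> : 2 * pospart y = 0 by rewrite /pospart max_r ?mulr0// ltW.
  have nE : \forall z \near y, cst 0 z = pospart z ^+ 2.
    near=> z; rewrite /pospart /= max_r ?expr0n//.
    by apply: ltW; near: z; exact: lt_nbhsl.
  exact: near_eq_is_derive nE (is_derive_cst _ _ _).
- have -> : 2 * pospart y = 2 * y by rewrite /pospart max_l// ltW.
  have nE : \forall z \near y, z ^+ 2 = pospart z ^+ 2.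
    near=> z; rewrite /pospart /= max_l//.
    by apply: ltW; near: z; exact: lt_nbhsr.
  exact: near_eq_is_derive nE (is_derive_sqr _).
- have -> : 2 * pospart (0 : R) = 0 by rewrite /pospart maxxx mulr0.
  have E : (fun h : R => h^-1 *: (((fun y => pospart y ^+ 2) \o shift 0) (h *: 1)
      - pospart 0 ^+ 2)) = (fun h => Num.max h 0).
    apply/funext => h; rewrite /= addr0 [h *: 1]mulr1 /pospart maxxx expr0n/= subr0.
    have [h0|h0] := leP h 0; first by rewrite expr0n/= scaler0.
    by rewrite expr2 [LHS]mulrA mulVf ?mul1r// gt_eqF.
  have cM : Num.max h 0 @[h --> (0 : R)^'] --> (0 : R).
    apply/cvgrPdist_lt => d d0; near=> h.
    have hd : `|0 - h| < d.
      near: h; apply: nbhs_dnbhs; apply/nbhs_normP; by exists d.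
    rewrite sub0r normrN; rewrite sub0r normrN in hd.
    have [h0|h0] := leP h 0; first by rewrite normr0.
    exact: hd.
  by split; rewrite /derivable /derive E; [apply/cvg_ex; exists 0|apply: cvg_lim].
Unshelve. all: by end_near. Qed.

(** * Truncated principal values as integrals against [cut] *)

Section LK_truncations.
Context {R : realType} (n : nat) (s lam Lam : R) (K : 'rV[R]_n -> \bar R).
Hypotheses (lam0 : 0 < lam) (hK : Ls1 s lam Lam K).

Lemma Ls1_kernel_bounds : kernel_bounds s lam Lam (fine \o K).
Proof.
have [K0 KN Kb] := hK; split=> [y|y y0] /=; first by rewrite KN.
have [K1 K2 K3 K4] := Kb y y0.
have Kfin : K y \is a fin_num by rewrite ge0_fin_numE// (le_lt_trans K2)// ltry.
by split=> //; rewrite -lee_fin fineK.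
Qed.

Lemma Ls1_fineK y : y != 0 -> ((fine \o K) y)%:E = K y.
Proof.
move=> y0; have [K0 KN Kb] := hK; have [_ K2 _ _] := Kb y y0.
by rewrite /= fineK// ge0_fin_numE// (le_lt_trans K2)// ltry.
Qed.

Lemma measurable_off_ball x rho : measurable (@off_ball R n x rho).
Proof.
apply: (@measurable_rV_closed _ _ [set y | rho <= enorm (x - y)]).
apply: (closed_comp _ (@closed_ge _ rho)) => y _.
apply: continuous_comp; [exact: continuous_rVB|exact: continuous_enorm].
Qed.

(** The substitution y = x - z centres the truncation at the origin, the form in which the evenness
    of the kernel and shifts of z can be used. *)
Lemma LK_trunc_cut f x rho : 0 < rho ->
  (lebesgue_tuple R n).-integrable (off_ball x rho) (LK_integrand K f x) ->
  rV_integrable (fun z => (f x - f (x - z)) * cut (fine \o K) rho z) /\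
  LK_trunc K f x rho = rV_int (fun z => (f x - f (x - z)) * cut (fine \o K) rho z).
Proof.
move=> rho0 iK.
pose h y := (f x - f y) * cut (fine \o K) rho (x - y).
have E : LK_integrand K f x \_ (off_ball x rho) = EFin \o (h \o @rV_of_tuple R n).
  apply/funext => z; rewrite patchE /h /cut /=; case: ltP => zr.
    by rewrite memNset ?mulr0//= /off_ball/=; apply/negP; rewrite -ltNge.
  rewrite mem_set// /LK_integrand EFinM -Ls1_fineK//.
  by rewrite -enorm_gt0 (lt_le_trans rho0).
have ih : rV_integrable h.
  rewrite /rV_integrable -E; apply/integrable_restrict => //; last by rewrite setTI.
  exact: measurable_off_ball.
have hE : (fun z => h (-1 *: z + x)) = (fun z => (f x - f (x - z)) * cut (fine \o K) rho z).
  by apply/funext => z; rewrite /h scaleN1r [- z + x]addrC opprB addrCA subrr addr0.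
have n1 : `|-1| = 1 :> R by rewrite normrN1.
split; first by rewrite -hE; exact: rV_integrable_affine.
rewrite -hE rV_int_affine// /LK_trunc /rV_int /Rintegral; congr fine.
by rewrite [LHS]integral_mkcond E.
Qed.

End LK_truncations.

(** * The integral estimate *)

Section pointwise.
Context {R : realType}.
Implicit Types h d p q w psi : R.

Lemma near_bound h d p q w : 0 <= h -> `|d| <= h / 8 -> p * w <= p * q ->
  - (h ^+ 2 * p ^+ 2) + 2 * h ^+ 2 * p * w - (h - d) ^+ 2 * q ^+ 2 <=
  2 * h * d * p ^+ 2 + 8 * d ^+ 2 * p ^+ 2.
Proof.
move=> h0; rewrite ler_norml => /andP[d1 d2] pwq; rewrite -subr_ge0.
rewrite (_ : _ - _ = 2^-1 * (h * (q - p) - 4 * d * p) ^+ 2 +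
  h * (h / 2 - 2 * d) * (q - p) ^+ 2 + d ^+ 2 * q ^+ 2 +
  2 * h ^+ 2 * (p * q - p * w)); last by field.
have e1 : 0 <= h / 2 - 2 * d by lra.
apply: addr_ge0; [apply: addr_ge0; [apply: addr_ge0|]|].
- by rewrite mulr_ge0 ?invr_ge0 ?sqr_ge0.
- by rewrite mulr_ge0 ?sqr_ge0// mulr_ge0.
- by rewrite mulr_ge0 ?sqr_ge0.
- by rewrite mulr_ge0 ?subr_ge0// mulr_ge0 ?sqr_ge0.
Qed.

Lemma far_bound h hy p q w :
  - (h ^+ 2 * p ^+ 2) + 2 * h ^+ 2 * p * w - hy ^+ 2 * q ^+ 2 <=
  - (h ^+ 2 * p ^+ 2) + 2 * h ^+ 2 * p * w.
Proof. by rewrite gerBl mulr_ge0 ?sqr_ge0. Qed.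

(** For the region beyond b, where no cancellation is used: the term linear in w is taken in
    absolute value and ends up in a tail that vanishes as b grows. *)
Lemma tail_bound h p w psi : 0 <= psi <= 1 ->
  (1 - psi) * (- (h ^+ 2 * p ^+ 2) + 2 * h ^+ 2 * p * w) <=
  2 * h ^+ 2 * `|p| * `|w|.
Proof.
move=> /andP[psi0 psi1].
have c0 : 0 <= 2 * h ^+ 2 * `|p| * `|w|.
  by rewrite mulr_ge0// mulr_ge0// mulr_ge0// sqr_ge0.
apply: le_trans (_ : (1 - psi) * (2 * h ^+ 2 * `|p| * `|w|) <= _); last first.
  by rewrite ler_piMl//; lra.
rewrite ler_wpM2l ?subr_ge0//.
apply: le_trans (_ : 2 * h ^+ 2 * p * w <= _).
  by have := mulr_ge0 (sqr_ge0 h) (sqr_ge0 p); lra.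
rewrite -(mulrA _ p) -(mulrA _ `|p|) -normrM ler_wpM2l ?ler_norm//.
by rewrite mulr_ge0 ?sqr_ge0.
Qed.

End pointwise.

Section core.
Context {R : realType} (n : nat) (s lam Lam : R).
Hypotheses (s01 : 0 < s < 1) (lam0 : 0 < lam) (lamL : lam <= Lam).

Lemma continuous_reflect (f : 'rV[R]_n -> R) x : continuous f ->
  continuous (fun z : 'rV[R]_n => f (x - z)).
Proof.
move=> cf z; apply: (@continuous_comp _ _ _ (fun z : 'rV[R]_n => x - z) f).
  exact: continuous_rVB.
exact: cf.
Qed.

(* The bound |d z| = O(|z|) is too weak to integrate G1 uniformly in rho if s >= 1/2; the
   symmetry of k turns d into a second difference, which is O(|z|^2). *)
Lemma near_integral : exists2 C : R, 0 < C &
  forall (k f : 'rV[R]_n -> R) N a x r b rho, kernel_bounds s lam Lam k -> C11c f ->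
  C11_norm f = N%:E -> 0 <= a ->
  0 < r -> 2 * r <= b -> 0 < rho -> N * (2 * r) < f x ->
  let d (z : 'rV[R]_n) := a * f x - a * f (x - z) in
  let G1 (z : 'rV[R]_n) := (1 - cutoff r b z) *
    (if enorm z <= 2 * r then d z * cut k rho z else 0) in
  let G2 (z : 'rV[R]_n) := (1 - cutoff r b z) *
    (if enorm z <= 2 * r then d z ^+ 2 * cut k rho z else 0) in
  [/\ rV_integrable G1, rV_integrable G2,
      rV_int G1 <= a * N * (C * (2 * r) `^ (2 - 2 * s)) &
      rV_int G2 <= (a * N) ^+ 2 * (C * (2 * r) `^ (2 - 2 * s))].
Proof.
have [C C0 CM] := cut_sqr_integral_le n s01 lam0 lamL.
have [Cf _ cutI] := cut_integral_le n s01 lam0 lamL.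
exists C => // k f N a x r b rho kb fC fN a0 r0 rb rho0 Nr d G1 G2.
have r20 : 0 < 2 * r by rewrite mulr_gt0.
have [iM MC] := CM k rho (2 * r) kb rho0 r20.
set M := (fun z => _) in iM MC.
have [ic _] := cutI k rho kb rho0.
have N0 : 0 <= N by exact: le_trans (normr_ge0 _) (C11c_le fC fN 0).
have cut0 z := cut_ge0 lam0 z kb rho0.
have psi01 (z : 'rV[R]_n) : 0 <= 1 - cutoff r b z <= 1.
  by rewrite subr_ge0 cutoff_le1 gerBl cutoff_ge0.
have lipd z : `|d z| <= a * N * enorm z.
  rewrite /d -mulrBr normrM ger0_norm// -mulrA ler_wpM2l// distrC.
  by rewrite -[enorm z]enormN; exact: (C11c_lip fC fN).
have cd : continuous d.
  move=> z; apply: (@continuousB _ _ _ (cst (a * f x)) (fun z : 'rV[R]_n => a * f (x - z))).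
    exact: cst_continuous.
  apply: (@continuousM _ _ (cst a) (fun z : 'rV[R]_n => f (x - z))).
    exact: cst_continuous.
  by apply: continuous_reflect; exact: C11c_continuous fC fN.
have mpsi : rV_measurable (fun z : 'rV[R]_n => 1 - cutoff r b z).
  apply: measurable_funB => //.
  exact: (measurable_funT_rV (continuous_cutoff r0 rb)).
have mcut := cut_measurable kb rho0.
have md : rV_measurable d := measurable_funT_rV cd.
have mG1 : rV_measurable G1.
  exact: measurable_funM mpsi (@rV_measurable_restrict R n
    (fun z => d z * cut k rho z) (2 * r) (measurable_funM md mcut)).
have mG2 : rV_measurable G2.
  exact: measurable_funM mpsi (@rV_measurable_restrict R n
    (fun z => d z ^+ 2 * cut k rho z) (2 * r)
    (measurable_funM (measurable_funX 2 md) mcut)).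
(* Integrability alone may depend on [rho], so the first-order bound on [d] is enough here. *)
have iG1 : rV_integrable G1.
  apply: rV_integrable_le mG1 _ (rV_integrableZ (a * N * (2 * r)) ic) => z.
  rewrite /G1 normrM; have /andP[p0 p1] := psi01 z; rewrite (ger0_norm p0).
  case: (leP (enorm z) (2 * r)) => zr; last by rewrite normr0 mulr0 !mulr_ge0// ltW.
  rewrite normrM (ger0_norm (cut0 z)) mulrA ler_wpM2r//.
  apply: le_trans (_ : 1 * (a * N * (2 * r)) <= _); last by rewrite mul1r.
  apply: ler_pM => //; apply: le_trans (lipd z) _.
  by rewrite ler_wpM2l// mulr_ge0.
have G2M z : 0 <= G2 z <= (a * N) ^+ 2 * M z.
  have /andP[p0 p1] := psi01 z; rewrite /G2 /M; case: (leP (enorm z) (2 * r)) => zr;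
    last by rewrite !mulr0 !lexx.
  rewrite mulr_ge0 ?(mulr_ge0 (sqr_ge0 _))//= mulrA [leRHS]mulrA ler_wpM2r//.
  apply: le_trans (_ : 1 * ((a * N) ^+ 2 * enorm z ^+ 2) <= _); last by rewrite mul1r.
  apply: ler_pM; rewrite ?sqr_ge0// -exprMn -real_normK ?num_real//.
  by rewrite lerXn2r ?nnegrE// (le_trans (normr_ge0 _) (lipd z)).
have iG2 : rV_integrable G2.
  apply: rV_integrable_le mG2 _ (rV_integrableZ ((a * N) ^+ 2) iM) => z.
  by have /andP[g0 gM] := G2M z; rewrite ger0_norm.
split=> //; last first.
  apply: le_trans (_ : rV_int (fun z => (a * N) ^+ 2 * M z) <= _).
    apply: le_rV_int => //; first exact: rV_integrableZ.
    by move=> z; have /andP[] := G2M z.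
  by rewrite rV_intZ// ler_wpM2l// sqr_ge0.
have n1 : `|-1| = 1 :> R by rewrite normrN1.
have iG1' := rV_integrable_affine 0 n1 iG1.
have E := rV_int_affine 0 n1 iG1.
have -> : rV_int G1 = 2^-1 * rV_int (fun z => G1 z + G1 (-1 *: z + 0)).
  by rewrite rV_intD// E; field.
apply: le_trans (_ : 2^-1 * rV_int (fun z => (2 * (a * N)) * M z) <= _); last first.
  rewrite rV_intZ// [leLHS](_ : _ = a * N * rV_int M); last by field.
  by rewrite ler_wpM2l// mulr_ge0.
rewrite ler_wpM2l ?invr_ge0//; apply: le_rV_int.
- exact: rV_integrableD.
- exact: rV_integrableZ.
move=> z; rewrite addr0 scaleN1r /G1 cutoffN enormN (cutN _ _ kb) /M.
case: (leP (enorm z) (2 * r)) => zr; last by rewrite !mulr0 addr0.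
have /andP[p0 p1] := psi01 z.
rewrite -mulrDr -mulrDl mulrA [leRHS]mulrA ler_wpM2r//.
apply: le_trans (_ : (1 - cutoff r b z) * (2 * (a * N) * enorm z ^+ 2) <= _); last first.
  by rewrite ler_piMl// mulr_ge0 ?sqr_ge0// !mulr_ge0.
rewrite ler_wpM2l// /d opprK.
rewrite (_ : _ + _ = - (a * (f (x + z) + f (x - z) - 2 * f x))); last by ring.
apply: le_trans (ler_norm _) _; rewrite normrN normrM ger0_norm//.
rewrite (_ : 2 * (a * N) * enorm z ^+ 2 = a * (2 * N * enorm z ^+ 2)); last by ring.
rewrite ler_wpM2l//; apply: (C11c_second_difference fC fN).
by apply: le_lt_trans Nr; rewrite ler_wpM2l.
Qed.

(** Pointwise the integrand is eventually 0, and |g| dominates it. Applied to |w| k, this removes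
    the outer radius of the cutoff. *)
Lemma tail_cvg0 (g : 'rV[R]_n -> R) : rV_integrable g ->
  rV_int (fun z => g z - (if enorm z <= m%:R then g z else 0)) @[m --> \oo] --> (0 : R).
Proof.
move=> ig; have mg := rV_integrable_measurable ig.
have E : rV_int (fun _ : 'rV[R]_n => (0 : R)) = 0.
  by rewrite /rV_int /Rintegral integral0.
rewrite -[X in _ --> X]E; apply: (rV_int_dominated_cvg (g := fun z => `|g z|)).
- by move=> m; exact: rV_measurableB mg (rV_measurable_restrict m%:R mg).
- exact: measurable_cst.
- exact: integrable_norm ig.
- move=> z; apply: cvg_near_cst; near=> m.
  rewrite ifT ?subrr//; near: m; exact: nbhs_infty_ger.
- by move=> m z; case: ifP => _; rewrite ?subrr ?normr0 ?subr0.
Unshelve. all: by end_near. Qed.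


(** The pointwise inequalities, integrated with [rho] and [b] fixed. The integration by parts is a
    premise, and the weight [kap] of Young's inequality stays free until the constants are chosen
    together in [core_estimate]. *)
Lemma truncated_bound (k f u q : 'rV[R]_n -> R) (e x : 'rV[R]_n)
    a N r b rho kap sig Ci :
  kernel_bounds s lam Lam k -> C11c f -> C11_norm f = N%:E -> 0 <= a ->
  0 < r -> 2 * r <= b -> 0 < rho <= r / 2 -> 0 < kap -> 0 <= Ci ->
  8 * N * (2 * r) <= f x ->
  continuous u -> continuous ('D_e u) ->
  (forall y, q x * 'D_e u y <= q x * q y) -> q x * 'D_e u x = q x ^+ 2 ->
  let w := 'D_e u in
  let h := a * f x in
  let p := q x in
  let d (z : 'rV[R]_n) := a * f x - a * f (x - z) in
  let G1 (z : 'rV[R]_n) := (1 - cutoff r b z) *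
    (if enorm z <= 2 * r then d z * cut k rho z else 0) in
  let G2 (z : 'rV[R]_n) := (1 - cutoff r b z) *
    (if enorm z <= 2 * r then d z ^+ 2 * cut k rho z else 0) in
  let F (y : 'rV[R]_n) := (a * f y) ^+ 2 * q y ^+ 2 + sig * u y ^+ 2 in
  let TF (z : 'rV[R]_n) := (F x - F (x - z)) * cut k rho z in
  let Tw (z : 'rV[R]_n) := (w x - w (x - z)) * cut k rho z in
  let Tu (z : 'rV[R]_n) := (u x - u (x - z)) * cut k rho z in
  let A (z : 'rV[R]_n) := `|w (x - z)| * cut k rho z in
  rV_integrable TF -> rV_integrable Tw -> rV_integrable Tu ->
  rV_integrable G1 -> rV_integrable G2 ->
  `|rV_int (fun z => cutoff r b z * 'D_e u (x - z) * cut k (r / 2) z)| <=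
    Ci / r * rV_int (fun z => `|u (x - z) - u x| *
     (if enorm z <= 3 * b then cut k (r / 2) z else 0)) ->
  h ^+ 2 * Ci ^+ 2 / (r ^+ 2 * kap) <= sig ->
  rV_integrable A /\
  rV_int TF - 2 * h ^+ 2 * p * rV_int Tw - 2 * sig * u x * rV_int Tu <=
  2 * h * p ^+ 2 * rV_int G1 + 8 * p ^+ 2 * rV_int G2
  - h ^+ 2 * p ^+ 2 * (rV_int (fun z => cutoff r b z * cut k (r / 2) z)
                        - kap * rV_int (cut k (r / 2)))
  + 2 * h ^+ 2 * `|p| * rV_int (fun z => A z - (if enorm z <= b then A z else 0)).
Proof.
move=> kb fC fN a0 r0 rb /andP[rho0 rhor] kap0 Ci0 Nr cu cw qw qq w h p d G1 G2 F TF Tw Tu A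
  iF iw iu iG1 iG2 ibp sigle.
have r20 : 0 < r / 2 by rewrite divr_gt0.
have b0 : 0 < b by lra.
have N0 : 0 <= N by exact: le_trans (normr_ge0 _) (C11c_le fC fN 0).
have h0 : 0 <= h.
  by rewrite mulr_ge0//; apply: le_trans Nr; rewrite mulr_ge0 ?mulr_ge0// ltW.
have sig0 : 0 <= sig.
  apply: le_trans sigle; apply: divr_ge0; first by rewrite mulr_ge0 ?sqr_ge0.
  by rewrite mulr_ge0 ?sqr_ge0// ltW.
have [Cf _ cutI] := cut_integral_le n s01 lam0 lamL.
have [ic _] := cutI k rho kb rho0.
have [ic' _] := cutI k (r / 2) kb r20.
have cut0 z := cut_ge0 lam0 z kb rho0.
have cut0' z := cut_ge0 lam0 z kb r20.
have mcut := cut_measurable kb rho0.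
have mcut' := cut_measurable kb r20.
pose psi := @cutoff R n r b.
have psi0 z : 0 <= psi z <= 1 by rewrite cutoff_ge0 cutoff_le1.
have cpsi : continuous psi by exact: continuous_cutoff.
have mpsi := measurable_funT_rV cpsi.
pose ann (z : 'rV[R]_n) := if enorm z <= 3 * b then cut k (r / 2) z else 0.
have mann : rV_measurable ann by exact: rV_measurable_restrict.
have ann_le z : 0 <= ann z <= cut k (r / 2) z.
  by rewrite /ann; case: ifP => _; rewrite ?lexx cut0'.
have cut_cut z : cut k (r / 2) z <= cut k rho z.
  rewrite /cut; case: ltP => [_|zr]; first exact: cut0.
  by rewrite ltNge (le_trans rhor zr).
have psicut z : psi z * cut k (r / 2) z = psi z * cut k rho z.
  rewrite /cut; case: ltP => zr; last by rewrite ltNge (le_trans rhor zr).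
  by rewrite /psi cutoff_near ?mul0r//; lra.
pose U (z : 'rV[R]_n) := u (x - z) - u x.
have cU : continuous U.
  move=> z; apply: (@continuousB _ _ _ (fun z : 'rV[R]_n => u (x - z)) (cst (u x))).
    exact: continuous_reflect.
  exact: cst_continuous.
have iannl (g : 'rV[R]_n -> R) : continuous g -> rV_integrable (fun z : 'rV[R]_n => g z * ann z).
  move=> cg; apply: (rV_integrable_local (c := 3 * b) s01 lam0 lamL kb r20 cg mann).
    by move=> z; have /andP[? ?] := ann_le z; rewrite ger0_norm.
  by move=> z zb; rewrite /ann leNgt zb.
have iA : rV_integrable A.
  have i1 : rV_integrable (fun z => w x * cut k rho z - Tw z).
    by apply: rV_integrableB => //; exact: rV_integrableZ.
  have -> : A = (fun z => `|w x * cut k rho z - Tw z|).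
    apply/funext => z; rewrite /A /Tw mulrBl opprB addrCA subrr addr0.
    by rewrite normrM (ger0_norm (cut0 z)).
  exact: integrable_norm i1.
split=> //.
pose g3 (z : 'rV[R]_n) := psi z * cut k (r / 2) z.
pose g4 (z : 'rV[R]_n) := cutoff r b z * 'D_e u (x - z) * cut k (r / 2) z.
pose g5 (z : 'rV[R]_n) := A z - (if enorm z <= b then A z else 0).
pose g6 (z : 'rV[R]_n) := U z ^+ 2 * ann z.
have ig3 : rV_integrable g3.
  apply: rV_integrable_le ic'; first exact: rV_measurableM mpsi mcut'.
  move=> z; have /andP[p0 p1] := psi0 z.
  by rewrite ger0_norm ?mulr_ge0// ler_piMl.
have far0 z : 2 * b < enorm z -> g3 z = 0.
  by move=> /ltW zb; rewrite /g3 /psi cutoff_far ?mul0r.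
have g3le z : `|g3 z| <= cut k (r / 2) z.
  have /andP[p0 p1] := psi0 z.
  by rewrite ger0_norm ?mulr_ge0// ler_piMl.
have ig4 : rV_integrable g4.
  have i4 := rV_integrable_local (c := 2 * b) s01 lam0 lamL kb r20
    (continuous_reflect (x := x) cw) (rV_integrable_measurable ig3) g3le far0.
  by apply: eq_rV_integrable i4 => z; rewrite /g4 /g3 mulrCA mulrA.
have ig5 : rV_integrable g5.
  have mA := rV_integrable_measurable iA; apply: rV_integrable_le iA.
    exact: rV_measurableB mA (rV_measurable_restrict b mA).
  move=> z; have A0 : 0 <= A z by rewrite mulr_ge0.
  by rewrite /g5; case: ifP => _; rewrite ?subrr ?normr0// subr0 ger0_norm.
have ig6 : rV_integrable g6.
  apply: (iannl (fun z => U z ^+ 2)) => z.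
  by apply: (@continuous_comp _ _ _ U (fun t : R => t ^+ 2)); [exact: cU|exact: exprn_continuous].
have [i2 e2] := rV_int_lin (- (2 * h ^+ 2 * p)) iF iw.
have [i3 e3] := rV_int_lin (- (2 * sig * u x)) i2 iu.
have j1 := rV_integrableZ (2 * h * p ^+ 2) iG1.
have [j2 f2] := rV_int_lin (8 * p ^+ 2) j1 iG2.
have [j3 f3] := rV_int_lin (- (h ^+ 2 * p ^+ 2)) j2 ig3.
have [j4 f4] := rV_int_lin (2 * h ^+ 2 * p) j3 ig4.
have [j5 f5] := rV_int_lin (2 * h ^+ 2 * `|p|) j4 ig5.
have [j6 f6] := rV_int_lin (- sig) j5 ig6.
have main := le_rV_int i3 j6.
have {}main : rV_int TF - 2 * h ^+ 2 * p * rV_int Tw - 2 * sig * u x * rV_int Tu <=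
    2 * h * p ^+ 2 * rV_int G1 + 8 * p ^+ 2 * rV_int G2 - h ^+ 2 * p ^+ 2 * rV_int g3 +
    2 * h ^+ 2 * p * rV_int g4 + 2 * h ^+ 2 * `|p| * rV_int g5 - sig * rV_int g6.
  move: main; rewrite e3 e2 f6 f5 f4 f3 f2 (rV_intZ _ iG1) !mulNr; apply.
  move=> z; set c := cut k rho z.
  have c0 : 0 <= c := cut0 z.
  set y := x - z; set hy := a * f y.
  (* The terms at x collapse: p w(x) = p^2 turns h^2 p^2 - 2 h^2 p w(x) into -h^2 p^2, and the part
     with u becomes -sig (u(y) - u(x))^2. *)
  have -> : TF z + - (2 * h ^+ 2 * p) * Tw z + - (2 * sig * u x) * Tu z =
      (- (h ^+ 2 * p ^+ 2) + 2 * h ^+ 2 * p * w y - hy ^+ 2 * q y ^+ 2) * c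
      - sig * U z ^+ 2 * c.
    rewrite /TF /Tw /Tu /F -/y -/c /U -/y -/h -/hy.
    have E : p * w x = p ^+ 2 by exact: qq.
    transitivity ((h ^+ 2 * p ^+ 2 - 2 * h ^+ 2 * (p * w x) + 2 * h ^+ 2 * p * w y
       - hy ^+ 2 * q y ^+ 2 - sig * (u y - u x) ^+ 2) * c); first by rewrite /p; ring.
    by rewrite E; ring.
  have psiz : 0 <= psi z <= 1 by exact: psi0.
  have /andP[ps0 ps1] := psiz.
  have annz : ann z <= c.
    by have /andP[_ h1] := ann_le z; exact: le_trans h1 (cut_cut z).
  set X := - (h ^+ 2 * p ^+ 2) + 2 * h ^+ 2 * p * w y.
  have XQ : X - hy ^+ 2 * q y ^+ 2 <= X by exact: far_bound.
  have -> : 2 * h * p ^+ 2 * G1 z + 8 * p ^+ 2 * G2 z + - (h ^+ 2 * p ^+ 2) * g3 z +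
      2 * h ^+ 2 * p * g4 z + 2 * h ^+ 2 * `|p| * g5 z + - sig * g6 z =
      (2 * h * p ^+ 2 * G1 z + 8 * p ^+ 2 * G2 z) + psi z * X * c +
      2 * h ^+ 2 * `|p| * g5 z - sig * U z ^+ 2 * ann z.
    have -> : g3 z = psi z * c by exact: psicut.
    have -> : g4 z = w y * (psi z * c).
      by rewrite -psicut /g4 -/(psi z) -/y /w; ring.
    by rewrite /g6 /X; ring.
  apply: lerB; last first.
    by rewrite ler_wpM2l// mulr_ge0 ?sqr_ge0.
  have Az : A z = `|w y| * c by [].
  (* Near zone: 1 - psi times the near bound plus psi times the far bound, so that only the psi part
     has to be integrated by parts. *)
  have [z2r|z2r] := leP (enorm z) (2 * r).
    have zb : enorm z <= b by lra.
    rewrite /g5 /G1 /G2 z2r zb subrr mulr0 addr0 -/(psi z) -/c.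
    have dz : `|d z| <= h / 8.
      rewrite /d -mulrBr normrM ger0_norm// distrC /h -mulrA ler_wpM2l//.
      apply: le_trans (C11c_lip fC fN x (- z)) _; rewrite enormN.
      rewrite ler_pdivlMr//; apply: le_trans Nr; rewrite mulrC mulrA.
      by rewrite ler_wpM2l// mulr_ge0.
    have := near_bound h0 dz (qw y); rewrite -/p -/w (_ : h - d z = hy); last first.
      by rewrite /d /h /hy /y; ring.
    rewrite -/X => nb.
    rewrite [leRHS](_ : _ = ((1 - psi z) * (2 * h * d z * p ^+ 2 + 8 * d z ^+ 2 * p ^+ 2) +
      psi z * X) * c); last by ring.
    rewrite ler_wpM2r//.
    rewrite [leLHS](_ : _ = (1 - psi z) * (X - hy ^+ 2 * q y ^+ 2) +
      psi z * (X - hy ^+ 2 * q y ^+ 2)); last by ring.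
    by apply: lerD; rewrite ler_wpM2l// subr_ge0.
  rewrite /G1 /G2 (lt_geF z2r) !mulr0 addr0 add0r /g5.
  (* Up to b the cutoff is 1 and the far bound suffices; beyond b the defect 1 - psi is charged to
     the tail term. *)
  have [zb|zb] := leP (enorm z) b.
    have -> : psi z = 1 by rewrite /psi cutoff_mid// (ltW z2r).
    by rewrite subrr mulr0 addr0 mul1r ler_wpM2r.
  rewrite subr0 Az [leRHS](_ : _ = (psi z * X + 2 * h ^+ 2 * `|p| * `|w y|) * c); last by ring.
  rewrite ler_wpM2r//; apply: le_trans XQ _.
  have := tail_bound h p (w y) psiz; rewrite -/X.
  lra.
have iabs : rV_integrable (fun z => `|U z| * ann z).
  by apply: iannl => z; apply: continuous_comp; [exact: cU|exact: norm_continuous].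
have iann : rV_integrable ann.
  have i1 := iannl (cst (1 : R)) (fun z => @cst_continuous _ R 1 z).
  by apply: eq_rV_integrable i1 => z; rewrite mul1r.
(* Young's inequality under the integral: by [sigle] the difference of the two sides is at least
   kap^(-1) (h|p| kap - h Ci |U| / r)^2 times [ann]. The kernel mass then enters only with the
   factor kap. *)
have young : 2 * h ^+ 2 * p * rV_int g4 <=
    h ^+ 2 * p ^+ 2 * (kap * rV_int (cut k (r / 2))) + sig * rV_int g6.
  apply: le_trans (_ : 2 * h ^+ 2 * `|p| * (Ci / r * rV_int (fun z => `|U z| * ann z)) <= _).
    apply: le_trans (ler_norm _) _; rewrite normrM.
    have -> : `|2 * h ^+ 2 * p| = 2 * h ^+ 2 * `|p|.
      by rewrite normrM ger0_norm// mulr_ge0 ?sqr_ge0.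
    by rewrite ler_wpM2l// mulr_ge0 ?normr_ge0// mulr_ge0 ?sqr_ge0.
  apply: le_trans (_ : h ^+ 2 * p ^+ 2 * kap * rV_int ann + sig * rV_int g6 <= _); last first.
    rewrite lerD2r [leRHS]mulrA ler_wpM2l//.
      by rewrite mulr_ge0 ?(ltW kap0)// mulr_ge0 ?sqr_ge0.
    by apply: le_rV_int => // z; have /andP[] := ann_le z.
  rewrite mulrA -(rV_intZ _ iabs).
  have [k1 l1] := rV_int_lin sig (rV_integrableZ (h ^+ 2 * p ^+ 2 * kap) iann) ig6.
  rewrite -(rV_intZ _ iann) -l1; apply: le_rV_int => //; first exact: rV_integrableZ.
  move=> z; have /andP[an0 _] := ann_le z; rewrite /g6.
  rewrite [leRHS](_ : _ = (h ^+ 2 * p ^+ 2 * kap + sig * U z ^+ 2) * ann z); last by ring.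
  rewrite [leLHS]mulrA ler_wpM2r//.
  apply: le_trans (_ : h ^+ 2 * p ^+ 2 * kap + h ^+ 2 * Ci ^+ 2 / (r ^+ 2 * kap) * U z ^+ 2 <= _); last first.
    by rewrite lerD2l ler_wpM2r ?sqr_ge0.
  rewrite -(real_normK (num_real p)) -(real_normK (num_real (U z))) -subr_ge0.
  rewrite (_ : _ - _ = kap^-1 * (h * `|p| * kap - h * Ci / r * `|U z|) ^+ 2).
    by rewrite mulr_ge0 ?sqr_ge0// invr_ge0 ltW.
  by field; rewrite !gt_eqF.
move: main young; rewrite /g3 /g5 -/psi; lra.
Qed.

End core.

(* A bounds eta1, L bounds the C^(1,1) norm of eta2, and B is the constant of the
   time term. *)
Section core_estimate.
Context {R : realType} (n : nat) (s lam Lam A L B : R).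
Hypotheses (n0 : (0 < n)%N) (s01 : 0 < s < 1) (lam0 : 0 < lam) (lamL : lam <= Lam).
Hypotheses (A0 : 0 < A) (L0 : 0 < L) (B0 : 0 <= B).

Lemma core_estimate_degenerate (k f u q : 'rV[R]_n -> R) (x : 'rV[R]_n) (w : 'rV[R]_n -> R)
    a sig rho :
  kernel_bounds s lam Lam k -> 0 < rho -> 0 <= sig -> a * f x * q x = 0 ->
  let h := a * f x in
  let F (y : 'rV[R]_n) := (a * f y) ^+ 2 * q y ^+ 2 + sig * u y ^+ 2 in
  let TF (z : 'rV[R]_n) := (F x - F (x - z)) * cut k rho z in
  let Tw (z : 'rV[R]_n) := (w x - w (x - z)) * cut k rho z in
  let Tu (z : 'rV[R]_n) := (u x - u (x - z)) * cut k rho z in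
  rV_integrable TF -> rV_integrable Tw -> rV_integrable Tu ->
  B * a `^ (2 - 2 * s) * f x ^+ 2 * q x ^+ 2 +
  (rV_int TF - 2 * h ^+ 2 * q x * rV_int Tw - 2 * sig * u x * rV_int Tu) <= 0.
Proof.
move=> kb rho0 sig0 hq h F TF Tw Tu iF iw iu.
have -> : B * a `^ (2 - 2 * s) * f x ^+ 2 * q x ^+ 2 = 0.
  move: hq => /eqP; rewrite !mulf_eq0 => /orP[/orP[]|] /eqP ->.
  (* The exponent 2 - 2s must be nonzero here, since [powR] gives 0 to the power 0 the value 1. *)
  - rewrite powR0 ?mulr0 ?mul0r//; have /andP[_ s1] := s01.
    by rewrite gt_eqF//; lra.
  - by rewrite expr0n mulr0 mul0r.
  - by rewrite expr0n mulr0.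
have -> : 2 * h ^+ 2 * q x = 0.
  by rewrite (_ : _ * q x = 2 * h * (h * q x)); [rewrite [h * q x]hq mulr0|ring].
have [i1 e1] := rV_int_lin (- (2 * sig * u x)) iF iu.
rewrite add0r mul0r subr0 -mulNr -e1 -(mul0r (rV_int TF)) -(rV_intZ _ iF).
apply: le_rV_int => //; first exact: rV_integrableZ.
move=> z; rewrite mul0r /TF /Tu mulrA -mulrDl.
rewrite mulr_le0_ge0 ?(cut_ge0 lam0 z kb rho0)// /F.
have -> : (a * f x) ^+ 2 * q x ^+ 2 = 0 by rewrite -exprMn hq expr0n.
rewrite (_ : _ + _ = - ((a * f (x - z)) ^+ 2 * q (x - z) ^+ 2 +
  sig * (u x - u (x - z)) ^+ 2)); last by ring.
by rewrite oppr_le0 addr_ge0// mulr_ge0 ?sqr_ge0.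
Qed.

(** [sigma0] is fixed before the kernel, the weight and the point, whereas [rho0] may depend on all
    of them, as only the limit rho -> 0 is taken afterwards. *)
Lemma core_estimate : exists2 sigma0 : R, 0 < sigma0 &
  forall (k f u q : 'rV[R]_n -> R) (e x : 'rV[R]_n) a N sig,
  kernel_bounds s lam Lam k -> C11c f -> C11_norm f = N%:E -> N <= L ->
  (forall y, 0 <= f y) -> 0 <= a <= A -> sigma0 <= sig -> enorm e = 1 ->
  continuous u -> (forall y, derivable u y e) -> continuous ('D_e u) ->
  (forall y, q x * 'D_e u y <= q x * q y) -> q x * 'D_e u x = q x ^+ 2 ->
  let w := 'D_e u in
  let h := a * f x in
  let F (y : 'rV[R]_n) := (a * f y) ^+ 2 * q y ^+ 2 + sig * u y ^+ 2 in
  let TF rho (z : 'rV[R]_n) := (F x - F (x - z)) * cut k rho z in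
  let Tw rho (z : 'rV[R]_n) := (w x - w (x - z)) * cut k rho z in
  let Tu rho (z : 'rV[R]_n) := (u x - u (x - z)) * cut k rho z in
  (forall rho, 0 < rho ->
    [/\ rV_integrable (TF rho), rV_integrable (Tw rho) & rV_integrable (Tu rho)]) ->
  exists2 rho0 : R, 0 < rho0 & forall rho, 0 < rho <= rho0 ->
  B * a `^ (2 - 2 * s) * f x ^+ 2 * q x ^+ 2 +
  (rV_int (TF rho) - 2 * h ^+ 2 * q x * rV_int (Tw rho) -
   2 * sig * u x * rV_int (Tu rho)) <= 0.
Proof.
have /andP[s0 s1] := s01.
have [cl cl0 lowI] := kernel_integral_ge Lam s01 lam0 n0.
have [Cf Cf0 cutI] := cut_integral_le n s01 lam0 lamL.
have [Cn Cn0 nearI] := near_integral n s01 lam0 lamL.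
have [Ci Ci0 ibpI] := cutoff_integral_by_parts n s01 lam0 lamL.
pose c2 : R := 2^-1 `^ (- (2 * s)).
pose c3 : R := 2 `^ (- (2 * s)).
pose c4 : R := 2 `^ (2 - 2 * s).
have c20 : 0 < c2 by rewrite powR_gt0// invr_gt0.
have c30 : 0 < c3 by rewrite powR_gt0.
have c40 : 0 < c4 by rewrite powR_gt0.
(* Makes the error of Young's inequality, kap times the upper bound for the mass of [cut k (r / 2)],
   a quarter of the lower bound for the good term; three quarters remain. *)
pose kap := cl * c3 / (4 * Cf * c2).
have kap0 : 0 < kap by rewrite divr_gt0// ?mulr_gt0.
(* All adverse terms together are at most Ct h^(2-2s) p^2: the time term through f^2 = f^(2-2s)
   f^(2s), the two near terms with 10 = 2 + 8. *)
pose Ct := B * L `^ (2 * s) + 10 * (A * L) ^+ 2 * Cn * c4.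
have Ct0 : 0 < Ct.
  rewrite ltr_wpDl// ?mulr_ge0 ?powR_ge0// mulr_gt0// mulr_gt0// mulr_gt0//.
  by rewrite exprn_gt0// mulr_gt0.
pose v := 3 / 4 * cl * c3 / Ct.
have v0 : 0 < v by rewrite divr_gt0// !mulr_gt0// invr_gt0.
(* The first entry gives |d| <= h/8 on the near zone, the second r <= h, and the third lets the
   remaining three quarters of the good term, enlarged by eps^(-2s), outweigh Ct. *)
pose eps := Num.min (16 * A * L)^-1 (Num.min 1 (v `^ (2 * s)^-1)).
have eps0 : 0 < eps by rewrite !lt_min invr_gt0 !mulr_gt0//= ltr01 powR_gt0.
have eps1 : eps <= 1 by rewrite /eps !ge_min lexx orbT.
have epsAL : 16 * A * L * eps <= 1.
  rewrite -ler_pdivlMl ?mulr_gt0// mulr1; by rewrite /eps ge_min lexx.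
have epsv : eps `^ (2 * s) * Ct <= 3 / 4 * cl * c3.
  rewrite -ler_pdivlMr// -/v.
  apply: le_trans (_ : (v `^ (2 * s)^-1) `^ (2 * s) <= _); last first.
    by rewrite -powRrM mulVf ?powRr1 ?(ltW v0)// gt_eqF// mulr_gt0.
  apply: ge0_ler_powR; rewrite ?nnegrE ?powR_ge0 ?(ltW eps0)//.
    by rewrite mulr_ge0// ltW.
  by rewrite /eps !ge_min lexx !orbT.
have sigma0_gt0 : 0 < Ci ^+ 2 / (eps ^+ 2 * kap).
  by apply: divr_gt0; rewrite ?exprn_gt0// mulr_gt0 ?exprn_gt0.
exists (Ci ^+ 2 / (eps ^+ 2 * kap)) => //.
move=> k f u q e x a N sig kb fC fN NL f0 /andP[a0 aA] sigle e1 cu du cw qw qq.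
move=> w h F TF Tw Tu iT.
have sig0 : 0 <= sig by exact: le_trans (ltW sigma0_gt0) sigle.
have [hp|hp] := eqVneq (a * f x * q x) 0.
  exists 1 => // rho /andP[rho0 _]; have [iF iw iu] := iT rho rho0.
  exact: (core_estimate_degenerate kb rho0 sig0 hp iF iw iu).
have h0 : 0 < h.
  rewrite lt0r mulr_ge0// andbT; move: hp; by rewrite mulf_eq0 negb_or => /andP[].
have fx0 : 0 < f x.
  rewrite lt0r f0 andbT; apply/eqP => fx; by move: h0; rewrite /h fx mulr0 ltxx.
have N0 : 0 <= N by exact: le_trans (normr_ge0 _) (C11c_le fC fN 0).
pose p := q x.
pose r := eps * h.
have r0 : 0 < r by rewrite mulr_gt0.
have Nr : 8 * N * (2 * r) <= f x.
  rewrite (_ : 8 * N * (2 * r) = (16 * a * N * eps) * f x); last by rewrite /r /h; ring.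
  rewrite ler_piMl// ?(ltW fx0)//; apply: le_trans epsAL.
  rewrite ler_wpM2r ?(ltW eps0)// -!mulrA ler_wpM2l// ler_pM//.
have Nr' : N * (2 * r) < f x.
  apply: le_lt_trans (_ : f x / 8 < f x); last by lra.
  by rewrite ler_pdivlMr// [leLHS](_ : _ = 8 * N * (2 * r))//; ring.
have r20 : 0 < r / 2 by rewrite divr_gt0.
exists (r / 2) => // rho /andP[rho0 rhor].
have [iF iw iu] := iT rho rho0.
set J := rV_int (TF rho) - _ - _.
set T := B * _ * _ * _.
pose Av (z : 'rV[R]_n) := `|w (x - z)| * cut k rho z.
have rho01 : 0 < rho <= r / 2 by rewrite rho0.
have sigle' : h ^+ 2 * Ci ^+ 2 / (r ^+ 2 * kap) <= sig.
  rewrite [leLHS](_ : _ = Ci ^+ 2 / (eps ^+ 2 * kap))//.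
  by rewrite /r; field; rewrite !gt_eqF.
(* Only the tail still depends on b. The second condition places the cube of [kernel_integral_ge],
   at scale 2r, where the cutoff is 1. *)
have bnd b : 2 * r <= b -> Num.sqrt n%:R * (2 * (2 * r)) <= b ->
  rV_integrable Av /\
  T + J <= 2 * h ^+ 2 * `|p| * rV_int (fun z => Av z - (if enorm z <= b then Av z else 0)).
  move=> rb nb.
  pose d (z : 'rV[R]_n) := a * f x - a * f (x - z).
  pose G1 (z : 'rV[R]_n) := (1 - cutoff r b z) *
    (if enorm z <= 2 * r then d z * cut k rho z else 0).
  pose G2 (z : 'rV[R]_n) := (1 - cutoff r b z) *
    (if enorm z <= 2 * r then d z ^+ 2 * cut k rho z else 0).
  have [iG1 iG2] : [/\ rV_integrable G1, rV_integrable G2,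
      rV_int G1 <= a * N * (Cn * (2 * r) `^ (2 - 2 * s)) &
      rV_int G2 <= (a * N) ^+ 2 * (Cn * (2 * r) `^ (2 - 2 * s))].
    exact: (nearI k f N a x r b rho kb fC fN a0 r0 rb rho0 Nr').
  move=> G1le G2le.
  have ibp := ibpI k u e x r b kb e1 r0 rb cu du cw.
  have [iA main] := truncated_bound s01 lam0 lamL kb fC fN a0 r0 rb rho01 kap0
    (ltW Ci0) Nr cu cw qw qq iF iw iu iG1 iG2 ibp sigle'.
  split=> //.
  have [ic' cfle] := cutI k (r / 2) kb r20.
  pose g3 (z : 'rV[R]_n) := cutoff r b z * cut k (r / 2) z.
  pose tl := rV_int (fun z => Av z - (if enorm z <= b then Av z else 0)).
  have {}main : J <= 2 * h * p ^+ 2 * rV_int G1 + 8 * p ^+ 2 * rV_int G2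
     - h ^+ 2 * p ^+ 2 * (rV_int g3 - kap * rV_int (cut k (r / 2)))
     + 2 * h ^+ 2 * `|p| * tl by exact: main.
  have g30 z : 0 <= g3 z.
    by rewrite mulr_ge0 ?cutoff_ge0// (cut_ge0 lam0 z kb r20).
  have ig3 : rV_integrable g3.
    apply: rV_integrable_le ic'.
      apply: rV_measurableM; last exact: cut_measurable kb r20.
      exact: (measurable_funT_rV (continuous_cutoff r0 rb)).
    move=> z; rewrite ger0_norm// ler_piMl ?cutoff_le1//.
    exact: (cut_ge0 lam0 z kb r20).
  have g3le : cl * (2 * r) `^ (- (2 * s)) <= rV_int g3.
    apply: (lowI k g3 (2 * r) kb) => //; first by rewrite mulr_gt0.
    move=> z /andP[z1 z2]; rewrite /g3 cutoff_mid ?mul1r//; last first.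
      by rewrite z1 (le_trans z2).
    by rewrite /cut ltNge (_ : r / 2 <= enorm z)//; lra.
  pose Y := h `^ (2 - 2 * s).
  have Y0 : 0 <= Y by exact: powR_ge0.
  have rsE : h ^+ 2 * r `^ (- (2 * s)) * eps `^ (2 * s) = Y.
    rewrite /r powRM ?(ltW eps0) ?(ltW h0)// /Y -expr2_powRN//.
    rewrite [eps `^ (- _)]powRN; field.
    by rewrite gt_eqF// powR_gt0.
  have fL : f x <= L by exact: le_trans (le_trans (ler_norm _) (C11c_le fC fN x)) NL.
  have TE : T = B * f x `^ (2 * s) * Y * p ^+ 2.
    have fE : f x ^+ 2 = f x `^ (2 - 2 * s) * f x `^ (2 * s).
      rewrite -powRD; last by rewrite (gt_eqF fx0) implybT.
      by rewrite subrK powR_mulrn.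
    by rewrite /T /Y powRM// fE /p; ring.
  have Tle : T <= B * L `^ (2 * s) * Y * p ^+ 2.
    rewrite TE ler_wpM2r ?sqr_ge0// ler_wpM2r// ler_wpM2l//.
    by apply: ge0_ler_powR; rewrite ?nnegrE ?(ltW L0)// mulr_ge0// ltW.
  pose S := Cn * (2 * r) `^ (2 - 2 * s).
  have S0 : 0 <= S by rewrite mulr_ge0 ?powR_ge0// ltW.
  have SY : S <= Cn * (c4 * Y).
    rewrite ler_pM2l// powRM ?(ltW r0)// ler_pM2l//; apply: ge0_ler_powR.
    - by lra.
    - by rewrite nnegrE ltW.
    - by rewrite nnegrE ltW.
    - by rewrite ler_piMl// ltW.
  have AL0 : 0 <= A * L by rewrite mulr_ge0// ltW.
  have aNAL : a * N <= A * L by exact: ler_pM.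
  have hAL : h <= A * L by exact: ler_pM.
  have nearle : 2 * h * p ^+ 2 * rV_int G1 + 8 * p ^+ 2 * rV_int G2 <=
      10 * (A * L) ^+ 2 * Cn * c4 * Y * p ^+ 2.
    apply: le_trans (_ : 2 * (A * L) * p ^+ 2 * (A * L * S) + 8 * p ^+ 2 * ((A * L) ^+ 2 * S) <= _); last first.
      rewrite [leLHS](_ : _ = 10 * (A * L) ^+ 2 * p ^+ 2 * S); last by ring.
      rewrite [leRHS](_ : _ = 10 * (A * L) ^+ 2 * p ^+ 2 * (Cn * (c4 * Y))); last by ring.
      by rewrite ler_wpM2l// mulr_ge0 ?sqr_ge0// mulr_ge0 ?sqr_ge0.
    apply: lerD.
      apply: le_trans (_ : 2 * h * p ^+ 2 * (A * L * S) <= _).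
        rewrite ler_wpM2l//; first by rewrite mulr_ge0 ?sqr_ge0// mulr_ge0// ltW.
        by apply: le_trans G1le _; rewrite ler_wpM2r.
      have h2 : 2 * h * p ^+ 2 <= 2 * (A * L) * p ^+ 2.
        by rewrite ler_wpM2r ?sqr_ge0// ler_wpM2l.
      by rewrite ler_wpM2r// mulr_ge0.
    rewrite ler_wpM2l//; first by rewrite mulr_ge0 ?sqr_ge0.
    apply: le_trans G2le _; rewrite ler_wpM2r// lerXn2r ?nnegrE// mulr_ge0//.
  pose rs := r `^ (- (2 * s)).
  have rs0 : 0 <= rs by exact: powR_ge0.
  have farle : Ct * Y <= h ^+ 2 * (rV_int g3 - kap * rV_int (cut k (r / 2))).
    apply: le_trans (_ : h ^+ 2 * (3 / 4 * cl * c3 * rs) <= _); last first.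
      rewrite ler_wpM2l ?sqr_ge0//.
      rewrite (_ : 3 / 4 * cl * c3 * rs = cl * (c3 * rs) - kap * (Cf * (rs * c2))).
        apply: lerB; first by move: g3le; rewrite powRM ?(ltW r0).
        by rewrite ler_pM2l//; move: cfle; rewrite powRM ?(ltW r0) ?invr_ge0.
      by rewrite /kap; field; rewrite !gt_eqF.
    rewrite -rsE -/rs [leLHS](_ : _ = h ^+ 2 * (eps `^ (2 * s) * Ct * rs)); last by ring.
    by rewrite ler_wpM2l ?sqr_ge0// ler_wpM2r.
  have := ler_wpM2r (sqr_ge0 p) farle.
  rewrite -/tl; move: main nearle Tle; rewrite /Ct.
  set I1 := rV_int G1; set I2 := rV_int G2.
  set D3 := (rV_int g3 - kap * _) => main nearle Tle farp.
  lra.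
pose bmax := Num.max (2 * r) (Num.sqrt n%:R * (2 * (2 * r))).
have b1 : 2 * r <= bmax by rewrite le_max lexx.
have b2 : Num.sqrt n%:R * (2 * (2 * r)) <= bmax by rewrite le_max lexx orbT.
have [iA _] := bnd _ b1 b2.
have tail := tail_cvg0 iA.
(* [T + J] does not depend on m, so the vanishing of its upper bound along m gives the claim. *)
have : 2 * h ^+ 2 * `|p| * rV_int (fun z => Av z - (if enorm z <= m%:R then Av z else 0))
   @[m --> \oo] --> 2 * h ^+ 2 * `|p| * 0.
  by apply: cvgM => //; exact: cvg_cst.
rewrite mulr0 => /cvgr_to_ge; apply; near=> m.
have m1 : 2 * r <= m%:R by near: m; exact: nbhs_infty_ger.
have m2 : Num.sqrt n%:R * (2 * (2 * r)) <= m%:R by near: m; exact: nbhs_infty_ger.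
by have [] := bnd _ m1 m2.
Unshelve. all: by end_near. Qed.

End core_estimate.

(** * The time derivative and the passage to the limit *)

Section bernstein.
Context {R : realType} (n : nat) (s lam Lam N1 : R).
Hypothesis s01 : 0 < s < 1.

(** Undoing the power 2s in the sup bound yields the constant A of the integral estimate. *)
Lemma C01_norm_base_le (eta1 : R -> R) t :
  (forall t, 0 <= t <= 1 -> 0 <= eta1 t) ->
  C01_norm (fun t => eta1 t `^ (2 * s)) = N1%:E -> 0 <= t <= 1 ->
  eta1 t <= (`|N1| + 1) `^ (2 * s)^-1.
Proof.
move=> eta0 gN t01; have [gb _] := C01_norm_bounds gN; have et0 := eta0 _ t01.
have /andP[s0 _] := s01; have s20 : 0 < 2 * s by rewrite mulr_gt0.
have := gb _ t01; rewrite ger0_norm ?powR_ge0// => gt.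
have -> : eta1 t = (eta1 t `^ (2 * s)) `^ (2 * s)^-1.
  by rewrite -powRrM mulfV ?lt0r_neq0// powRr1.
apply: ge0_ler_powR; rewrite ?nnegrE ?powR_ge0 ?invr_ge0 ?(ltW s20)//.
apply: le_trans gt _; have := ler_norm N1; lra.
Qed.

(** The integral estimate enters as the last premise, for small truncation radii. It passes to the
    limit because each of the three principal values converges separately. *)
Lemma bernstein_inequality (Q : R -> R) (K : R -> 'rV[R]_n -> \bar R)
    (eta1 : R -> R) (eta2 : 'rV[R]_n -> R) (sigma : R) (e : 'rV[R]_n)
    (u : R -> 'rV[R]_n -> R) (t : R) (x : 'rV[R]_n) :
  (forall y z, Q y * z <= Q y * Q z) -> (forall y, Q y * y = Q y ^+ 2) ->
  (forall y : R, is_derive y 1 (fun y => Q y ^+ 2) (2 * Q y)) ->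
  Ls1 s lam Lam (K t) ->
  (forall t, 0 <= t <= 1 -> 0 <= eta1 t) ->
  C01_norm (fun t => eta1 t `^ (2 * s)) = N1%:E ->
  0 < t < 1 -> derivable (fun r => eta1 r `^ (2 * s)) t 1 -> smooth_pos u ->
  let F (t : R) (x : 'rV[R]_n) :=
    (eta1 t * eta2 x) ^+ 2 * Q (dspace e u t x) ^+ 2 + sigma * u t x ^+ 2 in
  LK_defined (K t) (F t) x -> LK_defined (K t) (dspace e u t) x ->
  LK_defined (K t) (u t) x ->
  (let k := fine \o K t in
   let q y := Q (dspace e u t y) in
   let w := 'D_e (u t) in
   let h := eta1 t * eta2 x in
   let Fq (y : 'rV[R]_n) := (eta1 t * eta2 y) ^+ 2 * q y ^+ 2 + sigma * u t y ^+ 2 in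
   let TF rho (z : 'rV[R]_n) := (Fq x - Fq (x - z)) * cut k rho z in
   let Tw rho (z : 'rV[R]_n) := (w x - w (x - z)) * cut k rho z in
   let Tu rho (z : 'rV[R]_n) := (u t x - u t (x - z)) * cut k rho z in
   (forall rho, 0 < rho ->
     [/\ rV_integrable (TF rho), rV_integrable (Tw rho) & rV_integrable (Tu rho)]) ->
   exists2 rho0 : R, 0 < rho0 & forall rho, 0 < rho <= rho0 ->
   `|N1| / s * eta1 t `^ (2 - 2 * s) * eta2 x ^+ 2 * q x ^+ 2 +
   (rV_int (TF rho) - 2 * h ^+ 2 * q x * rV_int (Tw rho) -
    2 * sigma * u t x * rV_int (Tu rho)) <= 0) ->
  parab K F t x <=
    2 * (eta1 t * eta2 x) ^+ 2 * parab K (dspace e u) t x * Q (dspace e u t x)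
    + 2 * sigma * parab K u t x * u t x.
Proof.
move=> Qle QQ Qder hK eta0 gN t01 gder su F [iF cF] [iw cw] [iu cu] core.
have /andP[t0 t1] := t01; have /andP[s0 s1] := s01.
have trunc f rho : 0 < rho ->
    (forall r, 0 < r -> (lebesgue_tuple R n).-integrable (off_ball x r) (LK_integrand (K t) f x)) -> _ :=
  fun rho0 i => LK_trunc_cut hK rho0 (i rho rho0).
have [|rho0 rho00 coreP] := core.
  move=> rho r0; split.
  - exact: (trunc (F t) rho r0 iF).1.
  - exact: (trunc (dspace e u t) rho r0 iw).1.
  - exact: (trunc (u t) rho r0 iu).1.
have [D Dder Dle] := is_derive_sqr_eta1 s01 t01 eta0 gN gder.
have [ut wt] := smooth_pos_time e su x t0.
set w := dspace e u t x in core coreP *.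
set w' := derive1 (fun r => dspace e u r x) t.
set u' := derive1 (fun r => u r x) t.
set h := eta1 t * eta2 x in coreP *.
(* The terms with w' and u' are the time parts of the right-hand side and cancel; the one with [D]
   is left for the integral estimate to absorb. *)
have Ft : derive1 (fun r => F r x) t =
    D * eta2 x ^+ 2 * Q w ^+ 2 + 2 * h ^+ 2 * w' * Q w + 2 * sigma * u' * u t x.
  rewrite derive1E.
  have dw : is_derive t 1 (fun r => dspace e u r x) w'.
    by rewrite /w' derive1E; exact: derivableP.
  have du : is_derive t 1 (fun r => u r x) u'.
    by rewrite /u' derive1E; exact: derivableP.
  have dq := @is_derive1_comp R (fun y => Q y ^+ 2) (fun r => dspace e u r x) t _ _ (Qder _) dw.
  have du2 := @is_derive1_comp R (fun y => y ^+ 2) (fun r => u r x) t _ _ (is_derive_sqr _) du.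
  have FE : (fun r => F r x) = (eta2 x ^+ 2 *: ((fun r => eta1 r ^+ 2) *
      ((fun y => Q y ^+ 2) \o (fun r => dspace e u r x))) +
      sigma *: ((fun y => y ^+ 2) \o (fun r => u r x)) : R -> R).
    apply/funext => r; rewrite /F exprMn.
    rewrite -[RHS]/(eta2 x ^+ 2 * (eta1 r ^+ 2 * Q (dspace e u r x) ^+ 2) + sigma * (u r x) ^+ 2).
    by ring.
  have dM := is_deriveM Dder dq.
  have dF := is_deriveD (is_deriveZ (eta2 x ^+ 2) dM) (is_deriveZ sigma du2).
  rewrite FE (@derive_val _ _ _ _ _ _ _ dF).
  rewrite -[LHS]/(eta2 x ^+ 2 * (eta1 t ^+ 2 * (2 * Q w * w') + Q w ^+ 2 * D) +
    sigma * (2 * u t x * u')).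
  by rewrite /h; ring.
have Tle : D * eta2 x ^+ 2 * Q w ^+ 2 <=
    `|N1| / s * eta1 t `^ (2 - 2 * s) * eta2 x ^+ 2 * Q w ^+ 2.
  rewrite ler_wpM2r ?sqr_ge0// ler_wpM2r ?sqr_ge0//.
  apply: le_trans (ler_norm _) _; apply: le_trans Dle _.
  by rewrite ler_wpM2r ?powR_ge0// ler_pM2r ?invr_gt0// ler_norm.
have lim : LK_trunc (K t) (F t) x r - 2 * h ^+ 2 * Q w * LK_trunc (K t) (dspace e u t) x r
    - 2 * sigma * u t x * LK_trunc (K t) (u t) x r @[r --> 0^'+] -->
   LK (K t) (F t) x - 2 * h ^+ 2 * Q w * LK (K t) (dspace e u t) x
    - 2 * sigma * u t x * LK (K t) (u t) x.
  apply: cvgB; first apply: cvgB.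
  - exact: cF.
  - by apply: cvgM; [exact: cvg_cst|exact: cw].
  - by apply: cvgM; [exact: cvg_cst|exact: cu].
have LKle : LK (K t) (F t) x - 2 * h ^+ 2 * Q w * LK (K t) (dspace e u t) x
    - 2 * sigma * u t x * LK (K t) (u t) x <=
    - (`|N1| / s * eta1 t `^ (2 - 2 * s) * eta2 x ^+ 2 * Q w ^+ 2).
  apply: cvgr_to_le lim _; near=> r.
  have r0 : 0 < r by near: r; exact: nbhs_right_gt.
  have rr : r <= rho0 by near: r; exact: nbhs_right_le.
  have := coreP r; rewrite r0 rr => /(_ isT).
  rewrite (trunc (F t) r r0 iF).2 (trunc (dspace e u t) r r0 iw).2 (trunc (u t) r r0 iu).2.
  by rewrite -lerBrDl sub0r; exact.
rewrite /parab Ft -/u' -/w' -/w -/h.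
move: (LK _ _ _) (LK _ _ _) (LK _ _ _) LKle Tle => X1 X2 X3 LKle Tle.
move: (`|N1| / s * _ * _ * _) (D * _ * _) Tle LKle => X4 X5 Tle LKle.
have := le_trans (lerD Tle LKle) (_ : _ <= 0).
rewrite subrr lexx => /(_ isT) h5; rewrite -subr_le0; apply: le_trans h5.
by rewrite le_eqVlt; apply/orP; left; apply/eqP; ring.
Unshelve. all: by end_near. Qed.

End bernstein.

Theorem theorem7p2 (R : realType) (n : nat) (s lam Lam N1 N2 : R)
    (hn : (0 < n)%N) (hs : 0 < s < 1) (hlam : 0 < lam) (hLam : lam <= Lam) :
  exists sigma0 : R, 0 < sigma0 /\
  forall (K : R -> 'rV[R]_n -> \bar R) (eta1 : R -> R) (eta2 : 'rV[R]_n -> R),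
    (forall t, 0 <= t -> Ls1 s lam Lam (K t)) ->
    (forall t, 0 <= t <= 1 -> 0 <= eta1 t) ->
    C01_norm (fun t => eta1 t `^ (2 * s)) = N1%:E ->
    C11c eta2 ->
    (forall x, 0 <= eta2 x) ->
    C11_norm eta2 = N2%:E ->
  let eta (t : R) (x : 'rV[R]_n) := eta1 t * eta2 x in
  let good (t : R) := 0 < t < 1 /\ derivable (fun r => eta1 r `^ (2 * s)) t 1 in
  forall (sigma : R) (e : 'rV[R]_n), sigma0 <= sigma -> enorm e = 1 ->
  (forall u : R -> 'rV[R]_n -> R, smooth_pos u ->
     let F (t : R) (x : 'rV[R]_n) :=
       eta t x ^+ 2 * dspace e u t x ^+ 2 + sigma * u t x ^+ 2 in
     (forall t x, good t ->
        [/\ LK_defined (K t) (F t) x,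
            LK_defined (K t) (dspace e u t) x &
            LK_defined (K t) (u t) x]) ->
     forall t x, good t ->
       parab K F t x <=
         2 * eta t x ^+ 2 * parab K (dspace e u) t x * dspace e u t x
         + 2 * sigma * parab K u t x * u t x) /\
  (forall v : R -> 'rV[R]_n -> R, smooth_pos v ->
     let G (t : R) (x : 'rV[R]_n) :=
       eta t x ^+ 2 * pospart (dspace e v t x) ^+ 2 + sigma * v t x ^+ 2 in
     (forall t x, good t ->
        [/\ LK_defined (K t) (G t) x,
            LK_defined (K t) (dspace e v t) x &
            LK_defined (K t) (v t) x]) ->
     forall t x, good t ->
       parab K G t x <=
         2 * eta t x ^+ 2 * parab K (dspace e v) t x * pospart (dspace e v t x)
         + 2 * sigma * parab K v t x * v t x).
Proof.
have /andP[s0 s1] := hs.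
(* [N1] and [N2] are arbitrary reals; the [+ 1] makes A and L positive, and B = |N1| / s comes from
   [is_derive_sqr_eta1]. Thus sigma0 depends on n, s, lam, Lam, N1 and N2 only. *)
have A0 : 0 < (`|N1| + 1) `^ (2 * s)^-1 :> R by rewrite powR_gt0// ltr_wpDl.
have L0 : 0 < `|N2| + 1 :> R by rewrite ltr_wpDl.
have B0 : 0 <= `|N1| / s by rewrite divr_ge0// ltW.
have [sigma0 sigma00 est] := core_estimate hn hs hlam hLam A0 L0 B0.
exists sigma0; split=> // K eta1 eta2 hK eta10 eta1N eta2C eta20 eta2N eta good
  sigma e sigmale e1.
have N2L : N2 <= `|N2| + 1 by have := ler_norm N2; lra.
have main (Q : R -> R) (u : R -> 'rV[R]_n -> R) :
    (forall y z, Q y * z <= Q y * Q z) -> (forall y, Q y * y = Q y ^+ 2) ->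
    (forall y : R, is_derive y 1 (fun y => Q y ^+ 2) (2 * Q y)) -> smooth_pos u ->
    let F (t : R) (x : 'rV[R]_n) :=
      eta t x ^+ 2 * Q (dspace e u t x) ^+ 2 + sigma * u t x ^+ 2 in
    forall t x, good t -> LK_defined (K t) (F t) x ->
      LK_defined (K t) (dspace e u t) x -> LK_defined (K t) (u t) x ->
    parab K F t x <= 2 * eta t x ^+ 2 * parab K (dspace e u) t x * Q (dspace e u t x)
      + 2 * sigma * parab K u t x * u t x.
  move=> Qle QQ Qder su F t x [t01 gder] dF dw du; have /andP[t0 t1] := t01.
  have hKt := hK _ (ltW t0); have t01' : 0 <= t <= 1 by rewrite !ltW.
  apply: (bernstein_inequality hs Qle QQ Qder hKt eta10 eta1N t01 gder su dF dw du).
  have [cu du' cw] := smooth_pos_space e su t0.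
  have etaA : 0 <= eta1 t <= (`|N1| + 1) `^ (2 * s)^-1.
    apply/andP; split; first exact: eta10.
    exact: (C01_norm_base_le hs eta10 eta1N t01').
  pose q y := Q (dspace e u t y).
  have qw y : q x * 'D_e (u t) y <= q x * q y by exact: Qle.
  have qq : q x * 'D_e (u t) x = q x ^+ 2 by exact: QQ.
  have est1 := est (fine \o K t) eta2 (u t) q e x (eta1 t) N2 sigma
    (Ls1_kernel_bounds hKt) eta2C eta2N N2L eta20 etaA sigmale e1.
  have est2 := est1 cu du'.
  have est3 := est2 cw.
  have est4 := est3 qw qq.
  move=> k q0 w h Fq TF Tw Tu iT.
  have est5 := est4 iT.
  exact: est5.
split=> u su F dF t x gt; have [dFt dw du] := dF t x gt.
  exact: (main id u (fun y z => lexx _) (fun y => erefl _) (@is_derive_sqr R) su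
    t x gt dFt dw du).
have pos_le (y z : R) : pospart y * z <= pospart y * pospart z.
  by rewrite /pospart ler_wpM2l// le_max lexx ?orbT.
have pos_sqr (y : R) : pospart y * y = pospart y ^+ 2.
  by rewrite /pospart; case: (leP y 0) => _; rewrite ?mul0r ?expr0n// expr2.
exact: (main (@pospart R) u pos_le pos_sqr (@is_derive_sqr_pospart R) su
  t x gt dFt dw du).
Qed.
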